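(* Let $d\ge 2$ and $n\ge 3$ be integers. For every choice of triangulations $j(\sigma)\in\{1,2\}$, one for each $\sigma\in\bigcup_k (L_k\cup U_k)$, the Nevo--Santos--Wilson sphere $\widetilde{B}\cup(\partial\widetilde{B}*o)$ (a simplicial $(2d-1)$-sphere) is shellable.
   Context: Simplicial complexes are finite and abstract; a face is identified with the simplex of all its subsets. $\Delta*\Gamma=\{F\cup G: F\in\Delta,\ G\in\Gamma\}$ is the join of complexes on disjoint vertex sets, and $\Delta*v$ is the cone over $\Delta$ with apex the vertex $v$. For a simplex, $\partial$ denotes the complex of its proper faces; for a simplicial $D$-ball $\Delta$, $\partial\Delta$ is the subcomplex whose facets are the $(D-1)$-faces contained in exactly one facet of $\Delta$. A pure $D$-dimensional simplicial complex is shellable if its facets can be totally ordered $F_1,\dots,F_r$ so that for all $j<i$ there is $m<i$ such that $F_i\cap F_m$ is a $(D-1)$-face containing $F_i\cap F_j$. Construction (Nevo--Santos--Wilson, Construction 3). Write $[N]=\{1,\dots,N\}$. For $\ell\in[d]$ let $P(1^\ell,\dots,n^\ell)$ be the path with vertices $1^\ell,\dots,n^\ell$ and facets $\{i^\ell,(i+1)^\ell\}$, $i\in[n-1]$ (the $d$ vertex sets are disjoint; superscripts are labels, not powers). Let $B$ be the join of these $d$ paths, a simplicial $(2d-1)$-ball. Each facet of $B$ has the form $\sigma=\{i_1^1,(i_1+1)^1,\dots,i_d^d,(i_d+1)^d\}$ and is written $\sigma=(i_1,\dots,i_d)\in[n-1]^d$; its index sum is $\sum\sigma=i_1+\cdots+i_d$.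 The letter $\sigma$ denotes a facet of $B$. For $k\in[\lceil d(n-1)/(d+2)\rceil]$ let $B_k$ be the subcomplex of $B$ (a $(2d-1)$-ball) whose facets are the $\sigma$ with $(k-1)(d+2)\le\sum\sigma\le k(d+2)-1$. Let $L_k=\{\sigma\in B_k:\sum\sigma=(k-1)(d+2)\}$ and $U_k=\{\sigma\in B_k:\sum\sigma=k(d+2)-1\}$ (either may be empty). Let $C_k$ be the set of $(2d-2)$-simplices of $\partial B_k$ not contained in any $\sigma\in L_k\cup U_k$. For each $k$ introduce a new vertex $o_k$. For $\sigma\in L_k\cup U_k$ let $D_\sigma=\sigma\cap\partial B_k$ (the complex of faces of $\sigma$ lying in $\partial B_k$), let $F_\sigma$ be the missing face of $D_\sigma$, i.e. the unique subset of $\sigma$ that is not a face of $D_\sigma$ but all of whose proper subsets are faces of $D_\sigma$, and let $G_\sigma=\sigma\setminus F_\sigma$. Put $$T_{\sigma,1}=F_\sigma*\partial(G_\sigma*o_k),\qquad T_{\sigma,2}=\partial F_\sigma*(G_\sigma*o_k).$$ For each $\sigma\in\bigcup_k(L_k\cup U_k)$ choose $j(\sigma)\in\{1,2\}$ arbitrarily and independently. Define $$\widetilde{B_k}=\bigcup_{\sigma\in L_k\cup U_k}T_{\sigma,j(\sigma)}\ \cup\bigcup_{\tau\in C_k}\tau*o_k,\qquad \widetilde{B}=\bigcup_k\widetilde{B_k}.$$ It is known that $\widetilde{B}$ is a simplicial $(2d-1)$-ball and that, for a further new vertex $o$, the complex $\widetilde{B}\cup(\partial\widetilde{B}*o)$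 is a simplicial $(2d-1)$-sphere; these are the Nevo--Santos--Wilson spheres. *)

(* Defs.v *)
From mathcomp Require Import all_boot.

Set Implicit Arguments.
Unset Strict Implicit.
Unset Printing Implicit Defensive.

(* A finite abstract simplicial complex on V is a family {set {set V}} of     *)
(* faces. A face of dimension D has D.+1 vertices; a simplex is identified    *)
(* with its vertex set S, and as a complex it is [powerset S].                *)
Section Complexes.

Variable V : finType.
Implicit Types (S A F G : {set V}) (X Y : {set {set V}}) (D : nat).

Definition simplicial_complex X : bool :=
  (set0 \in X) && [forall F in X, powerset F \subset X].

Definition facets X : {set {set V}} := [set F | maxset [in X] F].

Definition generated X : {set {set V}} :=
  [set A : {set V} | [exists F in X, A \subset F]].

Definition join X Y : {set {set V}} := [set F :|: G | F in X, G in Y].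

Definition cone X (v : V) : {set {set V}} := join X (powerset [set v]).

Definition simplex_boundary S : {set {set V}} :=
  [set A : {set V} | A \proper S].

(* The ridges of a D-dimensional complex are its faces with D vertices.       *)
Definition boundary D X : {set {set V}} :=
  generated [set A in X |
    (#|A| == D) && (#|[set F in facets X | A \subset F]| == 1)].

Definition missing_face X S F : bool :=
  [&& F \subset S, F \notin X & [forall G : {set V}, (G \proper F) ==> (G \in X)]].

Definition pure D X : bool :=
  simplicial_complex X && [forall F in facets X, #|F| == D.+1].

Definition shelling D X (s : seq {set V}) : Prop :=
  perm_eq s (enum (facets X)) /\
  forall i j, j < i < size s ->
    exists m, [/\ m < i,
      #|nth set0 s i :&: nth set0 s m| = D &
      nth set0 s i :&: nth set0 s j \subset nth set0 s i :&: nth set0 s m].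

Definition shellable D X : Prop := pure D X /\ exists s, shelling D X s.

End Complexes.

Section NevoSantosWilson.

Variables d n : nat.

(* The ceiling of d(n-1)/(d+2). When d+2 divides d(n-1), the facet of B of    *)
(* index sum d(n-1) lies in no block: the construction leaves it out.         *)
Definition nblocks : nat := (d * n.-1 + d.+1) %/ d.+2.

(* Superscripts, positions on the paths and block numbers are all shifted to  *)
(* start at 0.                                                                *)
Definition vertex : finType := ('I_d * 'I_n + 'I_nblocks + unit)%type.

Definition path_vertex (l : 'I_d) (i : 'I_n) : vertex := inl (inl (l, i)).
Definition block_apex (k : 'I_nblocks) : vertex := inl (inr k).
Definition outer_apex : vertex := inr tt.

Definition path_edge (l : 'I_d) (i : 'I_n.-1) : {set vertex} :=
  [set path_vertex l w | w : 'I_n & (w == i :> nat) || (w == i.+1 :> nat)].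

Definition path_complex (l : 'I_d) : {set {set vertex}} :=
  generated [set path_edge l i | i : 'I_n.-1].

Definition B : {set {set vertex}} :=
  \big[@join vertex/[set set0]]_(l < d) path_complex l.

(* A facet of B is encoded by its index vector; see [facets_B] below.         *)
Definition cell_index : finType := {ffun 'I_d -> 'I_n.-1}.
Implicit Type s : cell_index.

Definition cell s : {set vertex} := \bigcup_(l < d) path_edge l (s l).

Definition index_sum s : nat := \sum_(l < d) (s l).+1.

Implicit Type k : 'I_nblocks.

Definition block_min k : nat := k * d.+2.
Definition block_max k : nat := (k.+1 * d.+2).-1.

Definition block k : {set {set vertex}} :=
  [set A in B | [exists s : cell_index,
     (block_min k <= index_sum s <= block_max k) && (A \subset cell s)]].

Definition block_boundary k : {set {set vertex}} := boundary (2 * d).-1 (block k).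

(* The index sum alone places these facets of B in block k.                   *)
Definition lower k : {set cell_index} := [set s | index_sum s == block_min k].
Definition upper k : {set cell_index} := [set s | index_sum s == block_max k].

Definition side_ridges k : {set {set vertex}} :=
  [set A in block_boundary k | (#|A| == (2 * d).-1) &&
     [forall s in lower k :|: upper k, ~~ (A \subset cell s)]].

Definition cell_boundary k s : {set {set vertex}} :=
  powerset (cell s) :&: block_boundary k.

(* The missing face exists and is unique for s in lower k or upper k, the     *)
(* only case in which Fface is used.                                          *)
Definition Fface k s : {set vertex} :=
  odflt set0 [pick F | missing_face (cell_boundary k s) (cell s) F].

Definition Gface k s : {set vertex} := cell s :\: Fface k s.

Definition T1 k s : {set {set vertex}} :=
  join (powerset (Fface k s)) (simplex_boundary (block_apex k |: Gface k s)).

Definition T2 k s : {set {set vertex}} :=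
  join (simplex_boundary (Fface k s)) (powerset (block_apex k |: Gface k s)).

(* [j s] is [true] when T1 is chosen at s and [false] when T2 is; the values  *)
(* of j outside of the sets lower and upper are irrelevant.                   *)
Definition new_block (j : cell_index -> bool) k : {set {set vertex}} :=
  (\bigcup_(s in lower k :|: upper k) (if j s then T1 k s else T2 k s))
  :|: \bigcup_(A in side_ridges k) powerset (block_apex k |: A).

Definition new_ball (j : cell_index -> bool) : {set {set vertex}} :=
  \bigcup_(k < nblocks) new_block j k.

Definition NSW_sphere (j : cell_index -> bool) : {set {set vertex}} :=
  new_ball j :|: cone (boundary (2 * d).-1 (new_ball j)) outer_apex.

Lemma path_vertex_edge l w l' i :
  (path_vertex l w \in path_edge l' i) =
  (l == l') && ((w == i :> nat) || (w == i.+1 :> nat)).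
Proof.
apply/imsetP/andP => [[w' hw' [-> ->]]|[/eqP -> hw]].
  by rewrite eqxx; split=> //; move: hw'; rewrite inE.
by exists w => //; rewrite inE.
Qed.

Lemma cellP s l w : (path_vertex l w \in cell s) =
  ((w == s l :> nat) || (w == (s l).+1 :> nat)).
Proof.
apply/bigcupP/idP => [[l' _]|h].
  by rewrite path_vertex_edge => /andP [/eqP <-].
by exists l; rewrite // path_vertex_edge eqxx.
Qed.

Lemma mem_B (A : {set vertex}) :
  (A \in B) = [exists s : cell_index, A \subset cell s].
Proof.
have bigjoinP (r : seq 'I_d) (f : 'I_d -> {set vertex}) :
    (forall l, f l \in path_complex l) ->
    \bigcup_(l <- r) f l \in \big[@join vertex/[set set0]]_(l <- r) path_complex l.
  move=> hf; elim: r => [|l r IH]; first by rewrite !big_nil inE.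
  by rewrite !big_cons; apply/imset2P; exists (f l) (\bigcup_(l <- r) f l).
have bigjoin_elim (r : seq 'I_d) (X : {set vertex}) : uniq r ->
    X \in \big[@join vertex/[set set0]]_(l <- r) path_complex l ->
    exists2 f : 'I_d -> {set vertex},
      forall l, l \in r -> f l \in path_complex l & X = \bigcup_(l <- r) f l.
  elim: r X => [|l r IH] X /=.
    by move=> _; rewrite big_nil inE => /eqP ->; exists (fun _ => set0); rewrite ?big_nil.
  case/andP=> lr ur; rewrite big_cons => /imset2P [F G hF /(IH _ ur) [f hf ->] ->].
  exists (fun l' => if l' == l then F else f l') => [l'|].
    by rewrite inE; case: eqP => [-> //|_ /= /hf].
  rewrite big_cons eqxx; congr (_ :|: _).
  rewrite big_seq [RHS]big_seq; apply: eq_bigr => l' hl'.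
  by case: eqP => // e; move: lr; rewrite -e hl'.
apply/idP/existsP => [/(bigjoin_elim _ _ (index_enum_uniq _)) [f hf ->]|[s sAs]].
  have /fin_all_exists [g hg] l : exists i, f l \subset path_edge l i.
    have := hf l (mem_index_enum _); rewrite inE.
    by case/existsP=> F /andP [/imsetP [i _ ->] h]; exists i.
  exists (finfun g); apply/bigcupsP => l _.
  by apply: (subset_trans (hg l)); apply: (bigcup_max l); rewrite ?ffunE.
have -> : A = \bigcup_(l < d) (A :&: path_edge l (s l)).
  by rewrite -big_distrr /=; apply/esym/setIidPl.
apply: bigjoinP => l; rewrite inE; apply/existsP; exists (path_edge l (s l)).
by rewrite imset_f // subsetIr.
Qed.

Lemma cell_subset_inj s s' : cell s \subset cell s' -> s = s'.
Proof.
move/subsetP=> h; apply/ffunP => l; apply/val_inj => /=.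
have lt1 : (s l).+1 < n by rewrite -ltn_predRL.
have h0 := h (path_vertex l (Ordinal (ltnW lt1))).
have {h} := h (path_vertex l (Ordinal lt1)); move: h0.
rewrite !cellP /= !eqxx orbT eqSS => /(_ isT) /orP [/eqP //|/eqP -> /(_ isT)].
by rewrite !gtn_eqF.
Qed.

Lemma facets_B : facets B = [set cell s | s : cell_index].
Proof.
apply/setP => F; rewrite inE; apply/maxsetP/imsetP => [[]|[s _ ->]].
  rewrite [F \in B]mem_B => /existsP [s sFs] hmax; exists s => //.
  by rewrite (hmax (cell s)) // mem_B; apply/existsP; exists s.
split; first by rewrite /= mem_B; apply/existsP; exists s.
move=> G; rewrite /= mem_B => /existsP [s' sGs'] ssG.
have e := cell_subset_inj (subset_trans ssG sGs').
by apply/eqP; rewrite eqEsubset ssG andbT e.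
Qed.

End NevoSantosWilson.

(* Main.v *)
Require Import Defs.
From mathcomp Require Import all_boot zify.

(* Fix a block (or the outer cone) with apex o, and a cell s in it. Let F be  *)
(* the set of vertices of s whose opposite ridge lies on the boundary of the  *)
(* block; for s in L or U this is the missing face. All facets of the sphere  *)
(* are obtained from the simplices S = s + o, by deleting one vertex of F or, *)
(* where T1 is chosen, one vertex of G = S - F. The outer cone is the same    *)
(* construction for the union of all blocks.                                  *)
(*   Order the pairs (block, s) by block, the outer cone coming last, then by *)
(* index sum, then by a linear functional with strictly decreasing weights.   *)
(* Join x in F to y in G when the ridge S - {x, y} is shared with an earlier  *)
(* pair. For s in L or U every earlier facet misses both ends of an edge of   *)
(* this bipartite graph, and for the other cells it misses a vertex y joined  *)
(* to all of F. The graph has no induced matching of size two, so its         *)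
(* neighbourhoods are nested on either side, and deleting the vertices of F,  *)
(* or those of G, by decreasing degree extends the shelling over S. Whether   *)
(* T1 or T2 is chosen at s does not matter for the rest of the sphere, since  *)
(* both have the same boundary.                                               *)

(** The argument has an abstract half and a geometric half. [flip_shelling] produces a shelling from
    ranked pieces that carry a bipartite graph between F and G, given three facts. By [E_ridge], the
    ridge of an edge lies in an earlier piece and omits there one vertex of F and one of G; either
    triangulation of that piece then has a facet containing it, so the choices never interact. By
    [E_nested], neighbourhoods are nested. By [E_attach], a facet of a different piece of no larger
    rank misses both ends of an edge or, at an unflipped piece, a vertex joined to all of F. For the
    sphere these facts are [attached_ridge], [attached_nested] and [attached_covers]. Crossing a
    ridge of a cell is a unit step along one path, so they become inequalities between coordinates
    and index sums. The index sums of a block span d + 1, whereas raising each coordinate by at most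
    one adds at most d; a cell at one end of a block is thus too far from the other end to interfere
    with it. It remains to recognise the construction: [FfaceE] finds the missing faces,
    [new_ball_boundaryE] the boundary, which does not depend on the choices, and [NSW_sphereE] all
    facets. *)

Set Implicit Arguments.
Unset Strict Implicit.
Unset Printing Implicit Defensive.

(** * Complexes generated by their facets *)

Section Generated.

Variable V : finType.
Implicit Types (A F G : {set V}) (X Y : {set {set V}}).

Lemma generatedP X A :
  reflect (exists2 F, F \in X & A \subset F) (A \in generated X).
Proof.
rewrite inE; apply: (iffP existsP) => [[F /andP [h1 h2]]|[F h1 h2]];
  by exists F; rewrite ?h1.
Qed.

Lemma facets_generated D X :
  (forall F, F \in X -> #|F| = D) -> facets (generated X) = X.
Proof.
move=> unif; apply/setP => F; rewrite inE.
apply/maxsetP/idP => [[/generatedP [G GX FG] maxF]|FX].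
  by rewrite -(maxF G) //; apply/generatedP; exists G.
split=> [|G /generatedP [H HX GH] FG]; first by apply/generatedP; exists F.
apply/esym/eqP; rewrite eqEcard FG (unif F) // -(unif H) //.
exact: subset_leq_card.
Qed.

Lemma simplicial_complex_generated X :
  X != set0 -> simplicial_complex (generated X).
Proof.
case/set0Pn=> F FX; apply/andP; split.
  by apply/generatedP; exists F; rewrite ?sub0set.
apply/forall_inP => A /generatedP [G GX AG]; apply/subsetP => A'.
rewrite inE => A'A; apply/generatedP; exists G => //.
exact: subset_trans A'A AG.
Qed.

Lemma boundary_generated D X :
  (forall F, F \in X -> #|F| = D.+1) ->
  boundary D (generated X) =
  generated [set A : {set V} | (#|A| == D) && (#|[set F in X | A \subset F]|
    == 1)].
Proof.
move=> unif; rewrite /boundary (facets_generated unif); congr generated.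
apply/setP => A; rewrite !inE; apply: andb_idl.
case/andP=> _ /cards1P [F /setP /(_ F)]; rewrite !inE eqxx => /andP [FX AF].
by apply/existsP; exists F; rewrite FX.
Qed.

Lemma cone_generated X v :
  cone (generated X) v = generated [set v |: F | F in X].
Proof.
apply/setP => A; apply/imset2P/generatedP.
  case=> F G /generatedP [H HX FH]; rewrite inE => Gv ->.
  exists (v |: H); first exact: imset_f.
  by rewrite setUC; apply: setUSS.
case=> _ /imsetP [F FX ->] AF; exists (A :\ v) (A :&: [set v]).
- by apply/generatedP; exists F; rewrite // subDset.
- by rewrite inE subsetIr.
- by rewrite setUC setID.
Qed.

Lemma join_simplex_boundary F G A : [disjoint F & G] ->
  (A \in join (powerset F) (simplex_boundary G)) =
  (A \subset F :|: G) && ~~ (G \subset A).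
Proof.
move=> dFG; apply/imset2P/andP.
  case=> F' G'; rewrite !inE => F'F G'G ->; split.
    by apply: setUSS => //; apply: proper_sub.
  apply: contraTN G'G; rewrite properE negb_and => GFG'.
  apply/orP; right; rewrite negbK; apply/subsetP => x xG.
  move/subsetP: GFG' => /(_ x xG); rewrite inE => /orP [] // /(subsetP F'F) xF.
  by move: dFG; rewrite disjoint_subset => /subsetP /(_ x xF); rewrite inE xG.
case=> AFG GA; exists (A :&: F) (A :&: G).
- by rewrite inE subsetIr.
- by rewrite inE properE subsetIr subsetI subxx andbT.
- by rewrite -setIUr; apply/esym/setIidPl.
Qed.

Lemma joinC X Y : join X Y = join Y X.
Proof.
by apply/setP => A; apply/imset2P/imset2P => [] [F G h1 h2 ->];
  exists G F; rewrite // setUC.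
Qed.

Lemma join_boundary_simplex F G A : [disjoint F & G] ->
  (A \in join (simplex_boundary F) (powerset G)) =
  (A \subset F :|: G) && ~~ (F \subset A).
Proof.
by move=> dFG; rewrite joinC join_simplex_boundary 1?disjoint_sym // setUC.
Qed.

End Generated.

(** Lexicographic orders are coded as numbers in mixed radix, in [piece_key] and in [piece_rank]. *)
Lemma ltn_lexi a b m r r' : a < b -> r < m -> a * m + r < b * m + r'.
Proof.
move=> ab rm; apply: (@leq_trans (b * m)); last exact: leq_addr.
apply: (@leq_trans (a.+1 * m)); last by rewrite leq_mul2r ab orbT.
by rewrite mulSn addnC ltn_add2r.
Qed.

(** * Shelling a union of flipped and unflipped simplices *)

Section FlipShelling.

Variables (V P X : finType) (lab : P -> X -> V) (rank : P -> nat).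
Variables (act : pred P) (inF : P -> pred X) (flipped : pred P).
Variable E : P -> rel X.
Variable D : nat.

(* A piece [p] is the simplex with vertices [lab p x], where [x] ranges over  *)
(* all of [X]; with F the vertices satisfying [inF p] and G the others, it is *)
(* triangulated by F * boundary G if it is flipped and by boundary F * G if   *)
(* not. [E p x y] is meant for x in F and y in G, and records that the ridge  *)
(* opposite to both belongs to a piece of smaller rank.                       *)

Definition piece_facet p x : {set V} := lab p @: [set~ x].

Definition piece_valid (px : P * X) : bool :=
  act px.1 && (inF px.1 px.2 != flipped px.1).

Definition piece_degree p x :=
  if flipped p then #|[set y | E p y x]| else #|[set y | E p x y]|.

(** Within a piece, larger degree comes first and [enum_rank] breaks ties. Distinct pieces of equal
    rank may interleave, which is why [E_attach] allows equal ranks. *)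
Definition piece_key (px : P * X) : nat :=
  (rank px.1 * #|X|.+1 + (#|X| - piece_degree px.1 px.2)) * #|X|
  + enum_rank px.2.

Hypothesis lab_inj : forall p, injective (lab p).
Hypothesis cardX : #|X| = D.+2.
Hypothesis E_ridge : forall p x y, act p -> E p x y ->
  [/\ inF p x, ~~ inF p y &
    exists q x' y', [/\ act q, rank q < rank p, inF q x', ~~ inF q y' &
      (lab p @: (~: [set x; y])) \subset (lab q @: (~: [set x'; y']))]].
Hypothesis E_nested : forall p x y x' y', act p ->
  E p x y -> E p x' y' -> E p x y' || E p x' y.
Hypothesis E_attach : forall p q x', act p -> piece_valid (q, x') -> q != p ->
  rank q <= rank p ->
  (exists x y, [/\ E p x y, lab p x \notin piece_facet q x' &
                   lab p y \notin piece_facet q x']) \/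
  ~~ flipped p /\ (exists2 y, forall x, inF p x -> E p x y &
                   lab p y \notin piece_facet q x').

Lemma lab_piece_facet p x y : (lab p y \in piece_facet p x) = (y != x).
Proof. by rewrite mem_imset // !inE. Qed.

Lemma card_piece_facet p x : #|piece_facet p x| = D.+1.
Proof. by rewrite card_imset // cardsC1 cardX. Qed.

Lemma piece_degree_le p x : piece_degree p x <= #|X|.
Proof. by rewrite /piece_degree; case: ifP => _; apply: max_card. Qed.

Lemma piece_key_rank p q x y : rank p < rank q ->
  piece_key (p, x) < piece_key (q, y).
Proof.
move=> h; apply: ltn_lexi; last exact: ltn_ord.
by apply: ltn_lexi; rewrite // ltnS leq_subr.
Qed.

Lemma piece_key_degree p x y : piece_degree p y < piece_degree p x ->
  piece_key (p, x) < piece_key (p, y).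
Proof.
move=> h; apply: ltn_lexi; last exact: ltn_ord.
rewrite ltn_add2l ltn_sub2l //; exact: leq_trans h (piece_degree_le p x).
Qed.

Lemma piece_key_inj p x y : piece_key (p, x) = piece_key (p, y) -> x = y.
Proof.
have [h|h|h] := ltngtP (piece_degree p x) (piece_degree p y).
- by move=> e; have := piece_key_degree h; rewrite e ltnn.
- by move=> e; have := piece_key_degree h; rewrite e ltnn.
- by rewrite /piece_key /= h => /addnI /ord_inj /enum_rank_inj.
Qed.

(** The shared ridge omits x' in F and y' in G of the earlier piece, and one of these two is a
    vertex that the triangulation there deletes. *)
Lemma attach_ridge p x y a b :
  act p -> E p a b -> (x = a /\ y = b) \/ (x = b /\ y = a) ->
  exists rz, [/\ piece_valid rz, piece_key rz < piece_key (p, x) &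
    piece_facet p x :\ lab p y \subset piece_facet rz.1 rz.2].
Proof.
move=> actp Eab xyab.
have [_ _ [q [x' [y' [actq ltqp Fx' Gy' sub]]]]] := E_ridge actp Eab.
exists (q, if flipped q then y' else x'); split.
- by rewrite /piece_valid /= actq; case: ifP => _; rewrite ?Fx' ?(negbTE Gy').
- exact: piece_key_rank.
- apply: (@subset_trans _ _ (lab p @: (~: [set a; b]))).
    apply/subsetP => v; rewrite !inE => /andP [vy /imsetP [z zx vE]].
    move: zx vy; rewrite vE inE (inj_eq (lab_inj (p:=p))) inE => zx zy.
    by apply: imset_f; case: xyab => [] [<- <-]; rewrite !inE negb_or zx zy.
  apply: (subset_trans sub); apply: imsetS; apply/subsetP => z.
  by rewrite !inE negb_or => /andP [h1 h2]; case: ifP.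
Qed.

(** Let both ends of the edge a b be missed by the earlier facet. If x is joined to the end on the
    other side, the ridge opposite to both is already covered by an earlier piece. Otherwise the end
    on the side of x has larger degree than x, so its deletion gives an earlier facet of the same
    piece. *)
Lemma flip_step p x q x' : piece_valid (p, x) -> piece_valid (q, x') ->
  (p, x) != (q, x') -> piece_key (q, x') <= piece_key (p, x) ->
  exists y, exists rz, [/\ lab p y \in piece_facet p x,
    lab p y \notin piece_facet q x', piece_valid rz,
    piece_key rz < piece_key (p, x) &
    piece_facet p x :\ lab p y \subset piece_facet rz.1 rz.2].
Proof.
move=> vx vx' ne le.
have inside y : y != x ->  piece_facet p x :\ lab p y \subset piece_facet p y.
  move=> yx; apply/subsetP => v; rewrite !inE => /andP [vy /imsetP [z _ vE]].
  by move: vy; rewrite vE lab_piece_facet (inj_eq (lab_inj (p:=p))).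
have [eqp|neqp] := eqVneq q p.
  move: ne le vx'; rewrite eqp xpair_eqE eqxx /= => ne le vx'.
  exists x', (p, x'); split=> //; rewrite ?lab_piece_facet ?eqxx 1?eq_sym //.
    rewrite ltn_neqAle le andbT; apply: contra ne => /eqP /piece_key_inj ->.
    exact: eqxx.
  by apply: inside; rewrite eq_sym.
have le_rank : rank q <= rank p.
  by rewrite leqNgt; apply: contraL le => h; rewrite -ltnNge piece_key_rank.
case/andP: (vx) => /= actp modex.
set step := (ex _).
have attached a b y : E p a b -> lab p y \notin piece_facet q x' ->
    (x = a /\ y = b) \/ (x = b /\ y = a) -> step.
  move=> Eab yq xyab.
  have [rz [h1 h2 h3]] := attach_ridge actp Eab xyab.
  exists y, rz; split=> //; rewrite lab_piece_facet.
  have [Fa Gb _] := E_ridge actp Eab.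
  apply: contraNneq Gb => yx; suff -> : b = a by [];
    by case: xyab => [] [e1 e2]; rewrite -e1 -e2 yx.
have earlier y : inF p y != flipped p -> piece_degree p x < piece_degree p y ->
    lab p y \notin piece_facet q x' -> step.
  move=> my dy yq; have yx : y != x by apply: contraTneq dy => ->; rewrite ltnn.
  exists y, (p, y); split; rewrite ?lab_piece_facet //=.
  - by rewrite /piece_valid /= actp my.
  - exact: piece_key_degree.
  - exact: inside.
case: (E_attach actp vx' neqp le_rank) => [[a [b [Eab aq bq]]]|[nf [b Eb bq]]].
  have [Fa Gb _] := E_ridge actp Eab.
  case fp : (flipped p) modex => modex.
    have [/attached /(_ aq)|nE] := boolP (E p a x); first by apply; right.
    apply: (earlier b) => //; first by rewrite fp (negbTE Gb).
    (* By nestedness the neighbours of x are neighbours of b, and a is one of b only. *)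
    rewrite /piece_degree fp; apply: proper_card; apply/properP; split.
      apply/subsetP => y; rewrite !inE => Eyx.
      by case/orP: (E_nested actp Eyx Eab) => //; rewrite (negbTE nE).
    by exists a; rewrite inE.
  have [/attached /(_ bq)|nE] := boolP (E p x b); first by apply; left.
  apply: (earlier a) => //; first by rewrite fp Fa.
  rewrite /piece_degree fp; apply: proper_card; apply/properP; split.
    apply/subsetP => y; rewrite !inE => Exy.
    by case/orP: (E_nested actp Exy Eab) => //; rewrite (negbTE nE).
  by exists b; rewrite inE.
have Exb : E p x b by apply: Eb; case: (inF p x) modex; rewrite // (negbTE nf).
by apply: (attached x b b) => //; left.
Qed.

(** [flip_step] exhibits a vertex of the later facet that is missing from the earlier one. *)
Lemma piece_facet_inj px qy : piece_valid px -> piece_valid qy ->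
  piece_facet px.1 px.2 = piece_facet qy.1 qy.2 -> px = qy.
Proof.
case: px qy => [p x] [q y] /= vx vy e; apply/eqP; apply/negPn/negP => ne.
wlog le : p q x y vx vy e ne / piece_key (q, y) <= piece_key (p, x).
  move=> th; case: (leqP (piece_key (q, y)) (piece_key (p, x))) => [|/ltnW] le.
    exact: (th p q x y).
  by apply: (th q p y x) => //; rewrite eq_sym.
by case: (flip_step vx vy ne le) => z [rz [h1]]; rewrite -e h1.
Qed.

Lemma flip_shelling Y :
  facets Y = [set piece_facet px.1 px.2 | px in piece_valid] ->
  exists s, shelling D Y s.
Proof.
move=> facY; pose phi px := piece_facet px.1 px.2.
pose t := sort (relpre piece_key leq) (enum piece_valid).
have memt px : (px \in t) = piece_valid px by rewrite mem_sort mem_enum.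
exists (map phi t); split.
  apply: uniq_perm.
  - rewrite map_inj_in_uniq ?sort_uniq ?enum_uniq // => px qy; rewrite !memt.
    exact: piece_facet_inj.
  - exact: enum_uniq.
  - move=> F; rewrite mem_enum facY; apply/mapP/imsetP => [] [px h ->];
    by exists px => //; rewrite memt in h *.
have sorted_t : sorted (relpre piece_key leq) t.
  by apply: sort_sorted => px qy; apply: leq_total.
move=> i j; rewrite size_map => /andP [ltji ltit].
have px0 : P * X by case: (t) ltit => [|px0].
have ltjt := ltn_trans ltji ltit.
rewrite !(nth_map px0) //; set px := nth px0 t i; set qy := nth px0 t j.
have vpx : piece_valid px by rewrite -memt mem_nth.
have vqy : piece_valid qy by rewrite -memt mem_nth.
have ne : px != qy by rewrite nth_uniq ?sort_uniq ?enum_uniq // gtn_eqF.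
have mono a b : b < size t -> a <= b ->
    piece_key (nth px0 t a) <= piece_key (nth px0 t b).
  move=> bt ab; apply: (sorted_leq_nth _ _ _ sorted_t) => //.
  - by move=> x y z /=; apply: leq_trans.
  - by move=> x /=; apply: leqnn.
  - by rewrite inE (leq_ltn_trans ab).
have le : piece_key qy <= piece_key px by apply: mono => //; apply: ltnW.
have [y [rz [yp yq vrz lt_rz sub]]] : exists y rz, [/\ y \in phi px,
    y \notin phi qy, piece_valid rz, piece_key rz < piece_key px &
    phi px :\ y \subset phi rz].
  move: vpx vqy ne le; rewrite /phi; case: px {mono} => p x;
    case: qy => q x' /=.
  move=> vpx vqy ne le;
    have [y [rz [h1 h2 h3 h4 h5]]] := flip_step vpx vqy ne le.
  by exists (lab p y), rz.
have rzt : rz \in t by rewrite memt.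
have eq_rz : nth px0 t (index rz t) = rz by rewrite nth_index.
(* A larger intersection would make the two facets equal, against [piece_facet_inj]. *)
have cap : phi px :&: phi rz = phi px :\ y.
  apply/eqP; rewrite eq_sym eqEcard subsetI subsetDl sub /=.
  have := cardsD1 y (phi px); rewrite yp card_piece_facet add1n => -[<-].
  rewrite -ltnS -(card_piece_facet px.1 px.2) ltnNge; apply/negP => h.
  have /eqP hh : phi px :&: phi rz == phi px by rewrite eqEcard subsetIl.
  have e : phi px = phi rz.
    apply/eqP; rewrite eqEcard !card_piece_facet leqnn andbT.
    by rewrite -{1}hh subsetIr.
  by move: lt_rz; rewrite (piece_facet_inj vpx vrz e) ltnn.
exists (index rz t).
have ltm : index rz t < i.
  rewrite ltnNge; apply/negP => le_im.
  have := mono i (index rz t); rewrite index_mem eq_rz => /(_ rzt le_im).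
  by rewrite leqNgt lt_rz.
have ltmt := ltn_trans ltm ltit.
rewrite !(nth_map px0) // eq_rz -/px; split=> //;
  rewrite -/(phi px) -/(phi rz) cap.
  by have := cardsD1 y (phi px); rewrite yp card_piece_facet add1n => -[<-].
by rewrite subsetD1 subsetIl inE (negbTE yq) andbF.
Qed.

End FlipShelling.

(** * Cells, their ridges, index sums and weights *)

Section Cells.

Variables d N : nat.
Local Notation cell_index := (cell_index d N.+2).
Local Notation vertex := (vertex d N.+2).
Local Notation nblocks := (nblocks d N.+2).
Implicit Types (s t : cell_index) (l m : 'I_d) (c : bool).

(** With [n = N.+2] coordinates run from 0 to N, so [inord] never falls back on its default. *)
Definition corner s (x : 'I_d * bool) : vertex :=
  path_vertex x.1 (inord (s x.1 + x.2)).

Lemma coord_le s l : s l <= N.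
Proof. by have := ltn_ord (s l); rewrite /= ltnS. Qed.

Lemma corner_val s l c : nat_of_ord (inord (s l + c) : 'I_N.+2) = s l + c.
Proof. by apply: inordK; move: (coord_le s l); case: c; lia. Qed.

Lemma corner_eq s t (x y : 'I_d * bool) :
  (corner s x == corner t y) = (x.1 == y.1) && (s x.1 + x.2 == t y.1 + y.2).
Proof.
apply/eqP/andP => [[-> /(congr1 (@nat_of_ord _))]|[/eqP e1 /eqP e2]].
  by rewrite !corner_val => ->.
rewrite /corner e1; congr (path_vertex _ _); apply: ord_inj.
by rewrite !corner_val -e2 e1.
Qed.

Lemma corner_inj s : injective (corner s).
Proof.
move=> [l c] [m c'] /eqP; rewrite corner_eq /= => /andP [/eqP -> /eqP /addnI].
by case: c c' => [] [].
Qed.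

Lemma corner_cell s t l c : (corner s (l, c) \in cell t) =
  (s l + c == t l) || (s l + c == (t l).+1).
Proof. by rewrite cellP corner_val. Qed.

Lemma cellE s : cell s = corner s @: setT.
Proof.
apply/setP => v; apply/idP/imsetP => [|[[l c] _ ->]]; last first.
  by rewrite corner_cell; case: c; rewrite ?addn0 ?addn1 eqxx ?orbT.
case/bigcupP=> l _ /imsetP [w]; rewrite inE => hw ->.
exists (l, w != s l :> nat) => //; congr (path_vertex _ _); apply: ord_inj.
rewrite corner_val /=; case/orP: hw => /eqP ->; first by rewrite eqxx addn0.
by rewrite gtn_eqF // addn1.
Qed.

Lemma card_cell s : #|cell s| = 2 * d.
Proof.
by rewrite cellE card_imset ?cardsT ?card_prod ?card_ord ?card_bool 1?mulnC //;
  apply: corner_inj.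
Qed.

Lemma cell_inj : injective (@cell d N.+2).
Proof. by move=> s t e; apply: cell_subset_inj; rewrite e. Qed.

Lemma cell_index_eq s t : (forall l, s l = t l :> nat) -> s = t.
Proof. by move=> h; apply/ffunP => l; apply: val_inj; apply: h. Qed.

(** Every other path keeps both its vertices, which fixes the coordinate; path [l] keeps one vertex,
    which lies on at most two edges. *)
Lemma ridge_cells s l c t : cell s :\ corner s (l, c) \subset cell t ->
  t = s \/ (forall m, m != l -> t m = s m :> nat) /\
           (if c then (t l).+1 = s l :> nat else t l = (s l).+1 :> nat).
Proof.
move/subsetP=> h.
have sub m b : (m, b) != (l, c) -> corner s (m, b) \in cell t.
  move=> ne; apply: h; rewrite !inE (inj_eq (@corner_inj s)) ne corner_cell.
  by case: b {ne}; rewrite ?addn0 ?addn1 eqxx ?orbT.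
have off m : m != l -> t m = s m :> nat.
  move=> ml; have := sub m true; have := sub m false.
  by rewrite !corner_cell !xpair_eqE (negbTE ml) /= => /(_ isT) + /(_ isT); lia.
have on : corner s (l, ~~ c) \in cell t.
  by apply: sub; rewrite xpair_eqE eqxx; case: (c).
rewrite corner_cell in on.
have [e|ne] := eqVneq (t l : nat) (s l).
  by left; apply: cell_index_eq => m; have [->|/off] := eqVneq m l.
by right; split => //; move: on ne; clear; case: c => /=; lia.
Qed.

Definition set_coord s l i : cell_index :=
  [ffun m => if m == l then inord i else s m].

Lemma set_coordE s l i m : i <= N ->
  set_coord s l i m = (if m == l then i else s m) :> nat.
Proof. by move=> h; rewrite ffunE; case: eqP => // _; rewrite inordK. Qed.

Lemma sum_set_coord (w : 'I_d -> nat -> nat) s l i : i <= N ->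
  \sum_m w m (set_coord s l i m) + w l (s l) = \sum_m w m (s m) + w l i.
Proof.
move=> h; rewrite (bigD1 l) //= [in RHS](bigD1 l) //= set_coordE // eqxx.
under eq_bigr => m ml do rewrite set_coordE // (negbTE ml).
by rewrite -addnA addnC [X in X + _]addnC.
Qed.

Definition coord_weight s := \sum_(l < d) (d - l) * s l.

Lemma index_sum_set_coord s l i : i <= N ->
  index_sum (set_coord s l i) + s l = index_sum s + i.
Proof.
move=> h; apply: succn_inj; rewrite -!addnS.
exact: (sum_set_coord (fun _ j => j.+1)).
Qed.

Lemma coord_weight_set_coord s l i : i <= N ->
  coord_weight (set_coord s l i) + (d - l) * s l = coord_weight s + (d - l) * i.
Proof. by move=> h; apply: (sum_set_coord (fun m j => (d - m) * j)). Qed.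

Lemma index_sum_leq s t : (forall l, s l <= t l) -> index_sum s <= index_sum t.
Proof. by move=> h; apply: leq_sum => l _; rewrite ltnS. Qed.

Lemma index_sum_ltn s t l :
  (forall l, s l <= t l) -> s l < t l -> index_sum s < index_sum t.
Proof.
move=> h hl; rewrite /index_sum (bigD1 l) // [in X in _ < X](bigD1 l) //=.
by rewrite -addSn leq_add //; apply: leq_sum => m _; rewrite ltnS.
Qed.

Lemma index_sum_leqD s t : (forall l, s l <= (t l).+1) ->
  index_sum s <= index_sum t + d.
Proof.
move=> h; rewrite -[X in _ <= _ + X]card_ord -sum1_card -big_split /=.
by apply: leq_sum => l _; rewrite addn1 ltnS.
Qed.

Lemma index_sum_bounds s : d <= index_sum s <= d * N.+1.
Proof.
rewrite /index_sum -[X in X <= _]card_ord -sum1_card; apply/andP; split.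
  by apply: leq_sum => l _.
rewrite -[X in X * _]card_ord -sum_nat_const.
by apply: leq_sum => l _; rewrite ltnS coord_le.
Qed.

Lemma index_sum_ltP s t : index_sum s < index_sum t -> exists l, s l < t l.
Proof.
move=> h; apply/existsP; apply: contraLR h => /existsPn h; rewrite -leqNgt.
by apply: index_sum_leq => l; rewrite leqNgt h.
Qed.

Lemma leq_rearrange a b x y : b <= a -> x <= y ->
  a * x + b * y <= a * y + b * x.
Proof. by move=> /subnKC <- /subnKC <-; nia. Qed.

Lemma ltn_rearrange a b x y : b < a -> x < y -> a * x + b * y < a * y + b * x.
Proof. by move=> /subnKC <- /subnKC <-; nia. Qed.

(* All coordinates where [t] exceeds [s] would otherwise precede those where  *)
(* it is smaller, and moving weight to the left increases [coord_weight].     *)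
Lemma coord_weight_exchange s t : t != s -> index_sum t = index_sum s ->
  coord_weight t <= coord_weight s ->
  exists l m, [/\ l < m, t l < s l & s m < t m].
Proof.
move=> ne eqs lew.
suff /existsP [l /existsP [m /and3P [h1 h2 h3]]] :
    [exists l : 'I_d, exists m : 'I_d, [&& l < m, t l < s l & s m < t m]].
  by exists l, m.
apply: contraT => /existsPn h.
have {}h l m : t l < s l -> s m < t m -> m < l.
  move=> tl sm; have /existsPn /(_ m) := h l; rewrite tl sm /= !andbT -leqNgt.
  by rewrite leq_eqVlt => /predU1P [/ord_inj e|//]; move: tl sm; rewrite e; lia.
have [l0 tl0 min_l0] : exists2 l0, t l0 < s l0 & forall l, t l < s l -> l0 <= l.
  have [l tl] : exists l, t l < s l.
    apply/existsP; apply: contraR ne => /existsPn h'.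
    have le l : s l <= t l by rewrite leqNgt h'.
    apply/eqP/cell_index_eq => l; apply/eqP; rewrite eqn_leq le andbT leqNgt.
    by apply/negP => /(index_sum_ltn le); rewrite eqs ltnn.
  by case: (@arg_minnP _ l (fun l => t l < s l) (@nat_of_ord d) tl) => l0 h1
    h2; exists l0.
have [m0 sm0] : exists m, s m < t m.
  apply/existsP; apply: contraT => /existsPn h'.
  have le l : t l <= s l by rewrite leqNgt h'.
  by have := index_sum_ltn le tl0; rewrite eqs ltnn.
(* Since the index sums agree, the constant weight [d - l0] can be subtracted from all weights;
   every term of the difference then has the same sign. *)
suff : coord_weight s + (d - l0) * index_sum t <
       coord_weight t + (d - l0) * index_sum s by rewrite eqs ltn_add2r
         ltnNge lew.
rewrite /coord_weight /index_sum !big_distrr -!big_split /=.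
have term l : (d - l) * s l + (d - l0) * (t l).+1 <=
              (d - l) * t l + (d - l0) * (s l).+1.
  have [ll0|l0l] := ltnP l l0.
    have le : s l <= t l by rewrite leqNgt; apply/negP => /min_l0; lia.
    rewrite !mulnS addnCA [leqRHS]addnCA leq_add2l.
    by apply: leq_rearrange; rewrite // leq_sub2l // ltnW.
  have le : t l <= s l by rewrite leqNgt; apply/negP => /(h _ _ tl0); lia.
  rewrite !mulnS addnCA [leqRHS]addnCA leq_add2l addnC [leqRHS]addnC.
  by apply: leq_rearrange; rewrite // leq_sub2l.
rewrite (bigD1 m0) // [in X in _ < X](bigD1 m0) //= -addSn leq_add //.
  rewrite !mulnS addnCA [ltnRHS]addnCA ltn_add2l.
  by apply: ltn_rearrange; rewrite // ltn_sub2l ?h.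
by apply: leq_sum => l _; apply: term.
Qed.

End Cells.

(** * The pieces of the sphere, their graphs and their order *)

Section Pieces.

Variables d N : nat.
Local Notation cell_index := (cell_index d N.+2).
Local Notation vertex := (vertex d N.+2).
Local Notation nblocks := (nblocks d N.+2).
Implicit Types (s t : cell_index) (l m : 'I_d) (c : bool).
Hypothesis d_gt0 : 0 < d.
Variable j : cell_index -> bool.

(* [None] in first position stands for the outer cone.                        *)
Local Notation piece := (option 'I_nblocks * cell_index)%type.
(* [None] labels the apex of a piece, and [Some (l, c)] the vertex of its     *)
(* cell that lies on path [l] and is the upper end of its edge if [c] holds.  *)
Local Notation label := (option ('I_d * bool)).
Implicit Types (p q : piece) (k : option 'I_nblocks).

Definition apex k : vertex :=
  if k is Some i then block_apex i else outer_apex d N.+2.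

Definition piece_label p (x : label) : vertex :=
  if x is Some y then corner p.2 y else apex p.1.

Definition sum_min k : nat := if k is Some i then block_min i else 0.

Definition sum_max k : nat :=
  if k is Some i then block_max i else (nblocks * d.+2).-1.

Definition active p : bool := sum_min p.1 <= index_sum p.2 <= sum_max p.1.

(** Across the ridge opposite to the upper vertex of an edge lies the cell one step down that path;
    for the lower vertex, one step up. An exit is a step that leaves the path or the block. *)
Definition exits p (x : 'I_d * bool) : bool :=
  if x.2 then (p.2 x.1 == 0 :> nat) || (index_sum p.2 == sum_min p.1)
  else (p.2 x.1 == N :> nat) || (index_sum p.2 == sum_max p.1).

Definition exit_label p (x : label) : bool :=
  if x is Some y then exits p y else false.

(** For upper [y] the step across lowers the index sum. This suffices unless [x] is a lower vertex
    that exits only through the top layer; then the step at [x] must follow, and the resulting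
    exchange lowers the weight when [y.1 < x.1]. For lower [y] the sum rises, and only an exchange
    that also steps down at [x] can be earlier. *)
Definition attaches p (x y : 'I_d * bool) : bool :=
  if y.2 then [|| x.2, y.1 <= x.1 | p.2 x.1 == N :> nat]
  else [&& x.2, x.1 < y.1 & 0 < p.2 x.1].

(** The ridge opposite to the apex and [x] is a ridge of the cell itself. In the outer cone it is
    shared with the piece of the same cell in its block; in a block, with the previous block when
    the step at [x] goes down. *)
Definition attached p : rel label := fun x y =>
  [&& exit_label p x, ~~ exit_label p y &
    match x, y with
    | Some x, Some y => attaches p x y
    | Some x, None => (p.1 == None) || (x.2 && (0 < p.2 x.1))
    | None, _ => false
    end].

Definition flipped_piece p : bool :=
  if p.1 is Some i then j p.2 && (p.2 \in lower i :|: upper i) else false.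

Definition block_number k : nat := if k is Some i then i else nblocks.

Definition piece_rank p : nat :=
  (block_number p.1 * (\max_(s : cell_index) index_sum s).+1 + index_sum p.2)
  * (\max_(s : cell_index) coord_weight s).+1 + coord_weight p.2.

(** Combined with [index_sum_leqD], this keeps the two end layers of a block apart. *)
Lemma sum_min_max k : sum_min k + d < sum_max k.
Proof.
case: k => [k|]; rewrite /= /block_min /block_max; first by lia.
have : 0 < nblocks by rewrite divn_gt0 //; nia.
by case: nblocks => // K _; lia.
Qed.

Lemma piece_label_inj p : injective (piece_label p).
Proof. by case: p => k s [x|] [y|] //=;
  [move/corner_inj => ->|case: k|case: k]. Qed.

Lemma card_label : #|{: label}| = (2 * d).+1.
Proof. by rewrite card_option card_prod card_ord card_bool mulnC. Qed.

Lemma sum_max_block k : sum_max k < nblocks * d.+2.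
Proof.
case: k => [k|] /=; last by have := sum_min_max None; rewrite /=; lia.
rewrite /block_max; have := ltn_ord k.
by rewrite -(leq_pmul2r (ltn0Sn d.+1)); lia.
Qed.

Lemma rank_ltn p q : block_number p.1 < block_number q.1 \/
  block_number p.1 = block_number q.1 /\
  (index_sum p.2 < index_sum q.2 \/ index_sum p.2 = index_sum q.2 /\
     coord_weight p.2 < coord_weight q.2) ->
  piece_rank p < piece_rank q.
Proof.
have sumle s : index_sum s < (\max_(s : cell_index) index_sum s).+1 by
  rewrite ltnS leq_bigmax.
have wle s : coord_weight s < (\max_(s : cell_index) coord_weight s).+1 by
  rewrite ltnS leq_bigmax.
case=> [h|[e [h|[e' h]]]]; rewrite /piece_rank.
- by apply: ltn_lexi => //; apply: ltn_lexi.
- by apply: ltn_lexi; rewrite // e ltn_add2l.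
- by rewrite e e' ltn_add2l.
Qed.

Lemma rank_leq p q : piece_rank p <= piece_rank q ->
  block_number p.1 < block_number q.1 \/
  block_number p.1 = block_number q.1 /\
  (index_sum p.2 < index_sum q.2 \/ index_sum p.2 = index_sum q.2 /\
     coord_weight p.2 <= coord_weight q.2).
Proof.
rewrite leqNgt => h.
have [h1|h1|e1] := ltngtP (block_number p.1) (block_number q.1).
- by left.
- by case/negP: h; apply: rank_ltn; left.
have [h2|h2|e2] := ltngtP (index_sum p.2) (index_sum q.2).
- by right; split; [|left].
- by case/negP: h; apply: rank_ltn; right; split; [|left].
right; split => //; right; split => //; rewrite leqNgt.
apply/negP => h3; case/negP: h; apply: rank_ltn; right; split => //.
by right.
Qed.

(** * Ridges shared between pieces *)

Lemma ridge_subset k s t l c m c' (x' y' : 'I_d * bool) :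
  (forall r, r != l -> r != m ->
    [/\ t r = s r :> nat, r != x'.1 & r != y'.1]) ->
  (forall r b, (r == l) || (r == m) -> (r, b) != (l, c) -> (r, b) != (m, c') ->
    exists2 b' : bool, ((r, b') != x') && ((r, b') != y') &
      s r + b = t r + b') ->
  (piece_label (k, s) @: (~: [set Some (l, c); Some (m, c')])) \subset
  (piece_label (k, t) @: (~: [set Some x'; Some y'])).
Proof.
move=> off on; apply/subsetP => _ /imsetP [z zxy ->].
case: z zxy => [[r b]|]; rewrite !inE negb_or => /andP [zx zy]; last first.
  by apply/imsetP; exists None; rewrite ?inE.
have [b' /andP [bx by'] e] : exists2 b' : bool,
    ((r, b') != x') && ((r, b') != y') & s r + b = t r + b'.
  have [rxy|] := boolP ((r == l) || (r == m)); first exact: on.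
  rewrite negb_or => /andP [rl rm]; have [-> rx' ry'] := off r rl rm.
  by exists b => //; case: x' y' rx' ry' {off on} => [? ?] [? ?] /=;
    rewrite !xpair_eqE => /negbTE -> /negbTE ->.
apply/imsetP; exists (Some (r, b')); first by rewrite !inE negb_or bx by'.
by apply/eqP; rewrite /= corner_eq /= eqxx e eqxx.
Qed.

Lemma activeE k s : active (k, s) = (sum_min k <= index_sum s <= sum_max k).
Proof. by []. Qed.

Lemma exits_upper k s l :
  exits (k, s) (l, true) = (s l == 0 :> nat) || (index_sum s == sum_min k).
Proof. by []. Qed.

Lemma exits_lower k s l :
  exits (k, s) (l, false) = (s l == N :> nat) || (index_sum s == sum_max k).
Proof. by []. Qed.

Lemma attaches_upper k s l c m :
  attaches (k, s) (l, c) (m, true) = [|| c, m <= l | s l == N :> nat].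
Proof. by []. Qed.

Lemma attaches_lower k s l c m :
  attaches (k, s) (l, c) (m, false) = [&& c, l < m & 0 < s l].
Proof. by []. Qed.

Definition exitsE := (exits_upper, exits_lower).
Definition attachesE := (attaches_upper, attaches_lower).

Lemma move_coord s l i : i <= N -> exists t,
  [/\ t l = i :> nat, forall r, r != l -> t r = s r :> nat &
      index_sum t + s l = index_sum s + i].
Proof.
move=> h; exists (set_coord s l i); split; last exact: index_sum_set_coord.
  by rewrite set_coordE // eqxx.
by move=> r /negbTE rl; rewrite set_coordE // rl.
Qed.

Lemma exchange_coord s l m : l != m -> 0 < s l -> s m < N -> exists t,
  [/\ (t l).+1 = s l :> nat, t m = (s m).+1 :> nat,
    forall r, r != l -> r != m -> t r = s r :> nat,
    index_sum t = index_sum s &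
    l < m -> coord_weight t < coord_weight s].
Proof.
move=> lm sl sm.
have sl1 : (s l).-1 <= N by have := coord_le s l; lia.
have ml : (m == l) = false by rewrite eq_sym (negbTE lm).
pose u := set_coord s l (s l).-1.
have um : u m = s m :> nat by rewrite set_coordE // ml.
have hu := index_sum_set_coord s l sl1;
  have hu' := coord_weight_set_coord s l sl1.
have ht := index_sum_set_coord u m sm;
  have ht' := coord_weight_set_coord u m sm.
exists (set_coord u m (s m).+1); split.
- by rewrite set_coordE // (negbTE lm) set_coordE // eqxx prednK.
- by rewrite set_coordE // eqxx.
- by move=> r /negbTE rl /negbTE rm; rewrite !set_coordE // rm rl.
- by rewrite -/u in hu; lia.
- move=> ltlm; rewrite -/u in hu'; rewrite um mulnS in ht'.
  have [i si] : exists i, s l = i.+1 :> nat by exists (s l).-1; lia.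
  rewrite si mulnS in hu'; have := ltn_ord m.
  by move: hu' ht'; rewrite [_.+1.-1]/=; lia.
Qed.

(* If [x] and [y] lie on the same path, follow that path to the far end of    *)
(* the block. Otherwise cross the ridge opposite to [y]; if the ridge opposite*)
(* to [x] no longer leaves the block there, cross it as well.                 *)
Lemma ridge_neighbour k s x y :
  active (k, s) -> exits (k, s) x -> ~~ exits (k, s) y ->
  exists t x' y', [/\ active (k, t) && (t != s), exits (k, t) x',
    ~~ exits (k, t) y',
    attaches (k, s) x y -> index_sum t < index_sum s \/
      index_sum t = index_sum s /\ coord_weight t < coord_weight s &
    (piece_label (k, s) @: (~: [set Some x; Some y])) \subset
    (piece_label (k, t) @: (~: [set Some x'; Some y']))].
Proof.
have neq s1 s2 r : s1 r <> s2 r :> nat -> s1 != s2.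
  by move=> h; apply: contra_notN h => /eqP ->.
case: x y => [l c] [m c']; rewrite activeE => act xl ym.
have lh := sum_min_max k; have sl := coord_le s l; have sm := coord_le s m.
have [eml|neml] := eqVneq m l.
  rewrite eml in sm ym *; case: c c' xl ym => [] [] xl ym.
  - by rewrite xl in ym.
  (* The longest move up that path and block allow, so that the next step up exits. *)
  - pose i := minn (N - s l) (sum_max k - index_sum s).
    have [|t [tl toff sumt]] := @move_coord s l (s l + i); first by lia.
    rewrite !exitsE in xl ym;
      have [slN sumN] : s l < N /\ index_sum s < sum_max k by lia.
    exists t, (l, false), (l, true); rewrite activeE !exitsE attaches_lower;
      split.
    + by apply/andP; split; [lia|apply: (neq _ _ l); lia].
    + lia.
    + lia.
    + lia.
    + apply: ridge_subset => [r rl _|r b]; first by split; rewrite // toff.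
      by rewrite orbb => /eqP -> ; case: b; rewrite eqxx.
  - pose i := minn (s l) (index_sum s - sum_min k).
    have [|t [tl toff sumt]] := @move_coord s l (s l - i); first by lia.
    rewrite !exitsE in xl ym;
      have [sl0 sum0] : 0 < s l /\ sum_min k < index_sum s by lia.
    exists t, (l, true), (l, false); rewrite activeE !exitsE attaches_upper;
      split.
    + by apply/andP; split; [lia|apply: (neq _ _ l); lia].
    + lia.
    + lia.
    + lia.
    + apply: ridge_subset => [r rl _|r b]; first by split; rewrite // toff.
      by rewrite orbb => /eqP -> ; case: b; rewrite eqxx.
  - by rewrite xl in ym.
have mll := negbTE neml; have lml : (l == m) = false by rewrite eq_sym.
case: c' ym => ym; rewrite !exitsE in ym.
  have [sm0 sum0] : 0 < s m /\ sum_min k < index_sum s by lia.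
  have [stay|leave] := boolP (c || (s l == N :> nat)).
    have [|t [tm toff sumt]] := @move_coord s m (s m - 1); first by lia.
    have tl : t l = s l :> nat by rewrite toff // lml.
    exists t, (l, c), (m, false); rewrite activeE !exitsE; split.
    - by apply/andP; split; [lia|apply: (neq _ _ m); lia].
    - by case: c xl stay => xl stay; rewrite !exitsE in xl *; lia.
    - lia.
    - lia.
    - apply: ridge_subset => [r rl rm|r b]; first by split; rewrite // toff.
      case/orP => /eqP -> h1 h2; first by exists b;
        rewrite ?tl // h1 xpair_eqE lml.
      exists true; first by rewrite !xpair_eqE mll eqxx.
      by move: h2; rewrite xpair_eqE eqxx; case: (b) => // _; lia.
  have [ec slN] : c = false /\ s l < N by case: (c) leave => //; lia.
  rewrite ec exitsE in xl *;
    have [t [tm tl toff sumt wt]] := exchange_coord neml sm0 slN.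
  exists t, (m, false), (l, true); rewrite activeE !exitsE attaches_upper;
    split.
  - by apply/andP; split; [lia|apply: (neq _ _ m); lia].
  - lia.
  - lia.
  - move=> att; right; split=> //; apply: wt.
    have : (m : nat) != l by [].
    lia.
  - apply: ridge_subset => [r rl rm|r b]; first by split; rewrite // toff.
    case/orP => /eqP -> h1 h2.
      exists false; first by rewrite !xpair_eqE lml eqxx andbF.
      by move: h1; rewrite xpair_eqE eqxx; case: (b) => // _; lia.
    exists true; first by rewrite !xpair_eqE mll eqxx.
    by move: h2; rewrite xpair_eqE eqxx; case: (b) => // _; lia.
have [smN sum0] : s m < N /\ index_sum s < sum_max k by lia.
have [stay|leave] := boolP (~~ c || (s l == 0 :> nat)).
  have [|t [tm toff sumt]] := @move_coord s m (s m + 1); first by lia.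
  have tl : t l = s l :> nat by rewrite toff // lml.
  exists t, (l, c), (m, true); rewrite activeE !exitsE attaches_lower; split.
  - by apply/andP; split; [lia|apply: (neq _ _ m); lia].
  - by case: c xl stay => xl stay; rewrite !exitsE in xl *; lia.
  - lia.
  - by case: (c) stay => //=; lia.
  - apply: ridge_subset => [r rl rm|r b]; first by split; rewrite // toff.
    case/orP => /eqP -> h1 h2; first by exists b;
      rewrite ?tl // h1 xpair_eqE lml.
    exists false; first by rewrite !xpair_eqE mll eqxx.
    by move: h2; rewrite xpair_eqE eqxx; case: (b) => // _; lia.
have [ec sl0] : c = true /\ 0 < s l by case: (c) leave => //; lia.
rewrite ec exitsE in xl *.
have neqlm : l != m by rewrite lml.
have [t [tl tm toff sumt wt]] := exchange_coord neqlm sl0 smN.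
exists t, (m, true), (l, false); rewrite activeE !exitsE attaches_lower; split.
- by apply/andP; split; [lia|apply: (neq _ _ m); lia].
- lia.
- lia.
- by move=> att; right; split=> //; apply: wt; lia.
- apply: ridge_subset => [r rl rm|r b]; first by split; rewrite // toff.
  case/orP => /eqP -> h1 h2.
    exists true; first by rewrite !xpair_eqE lml eqxx andbF.
    by move: h1; rewrite xpair_eqE eqxx; case: (b) => // _; lia.
  exists false; first by rewrite !xpair_eqE mll eqxx.
  by move: h2; rewrite xpair_eqE eqxx; case: (b) => // _; lia.
Qed.

Lemma ridge_subset_apex k k' s t (x x' : 'I_d * bool) :
  (forall r b, (r, b) != x ->
    exists2 b' : bool, (r, b') != x' & s r + b = t r + b') ->
  (piece_label (k, s) @: (~: [set Some x; None])) \subset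
  (piece_label (k', t) @: (~: [set Some x'; None])).
Proof.
move=> h; apply/subsetP => _ /imsetP [z zxy ->].
case: z zxy => [[r b]|]; rewrite !inE negb_or ?andbF //= => /andP [zx _].
have [b' bx e] := h r b zx.
apply/imsetP; exists (Some (r, b')); first by rewrite !inE negb_or andbT.
by apply/eqP; rewrite /= corner_eq /= eqxx e eqxx.
Qed.

Lemma sum_max_lt_min (i i' : 'I_nblocks) : i < i' ->
  sum_max (Some i) < sum_min (Some i').
Proof.
rewrite /= /block_max /block_min => h.
by move: h; rewrite -(@leq_pmul2r d.+2) //; lia.
Qed.

Lemma sum_max_block_outer (i : 'I_nblocks) :
  sum_max (Some i) <= sum_max (None : option 'I_nblocks).
Proof.
rewrite /= /block_max; have := ltn_ord i.
by rewrite -(@leq_pmul2r d.+2) //; lia.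
Qed.

Lemma active_outer k s : active (k, s) -> active (None, s).
Proof.
case: k => [i|//]; rewrite !activeE => /andP [_ h].
by rewrite leq0n (leq_trans h) ?sum_max_block_outer.
Qed.

Lemma active_block s : active (None, s) ->
  exists i : 'I_nblocks, active (Some i, s).
Proof.
rewrite activeE => /andP [_ h].
have lt : index_sum s %/ d.+2 < nblocks.
  rewrite ltn_divLR //; apply: leq_ltn_trans h _.
  exact: (sum_max_block None).
exists (Ordinal lt); rewrite activeE /= /block_min /block_max /=.
have := divn_eq (index_sum s) d.+2;
  have := ltn_pmod (index_sum s) (ltn0Sn d.+1).
by move: (_ %/ _) (_ %% _) => a b; lia.
Qed.

Lemma active_block_inj s (i i' : 'I_nblocks) :
  active (Some i, s) -> active (Some i', s) -> i = i'.
Proof.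
move=> h h'; apply: ord_inj; move: h h'; rewrite !activeE => h h'.
by have [/sum_max_lt_min|/sum_max_lt_min|//] := ltngtP i i'; lia.
Qed.

(** A step that leaves the block but not the path crosses its first or last layer into the adjacent
    block, where the same ridge exits in the opposite direction. *)
Lemma apex_ridge_neighbour (i : 'I_nblocks) s x :
  active (Some i, s) -> exits (Some i, s) x ->
  exits (None, s) x \/
  exists i' t x', [/\ active (Some i', t), i' != i, exits (Some i', t) x',
    x.2 && (0 < s x.1) -> i' < i &
    (piece_label (Some i, s) @: (~: [set Some x; None])) \subset
    (piece_label (Some i', t) @: (~: [set Some x'; None]))].
Proof.
case: x => l c; rewrite activeE => act.
have pos := index_sum_bounds s; have sl := coord_le s l.
case: c; rewrite !exitsE.
  have [_ _|sl0 /= /eqP sumE] := posnP (s l); first by left.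
  right; have i_gt0 : 0 < i by move: sumE; rewrite /= /block_min;
    case: (nat_of_ord i) => //; lia.
  have i'P : i.-1 < nblocks by have := ltn_ord i; lia.
  have [|t [tl toff sumt]] := @move_coord s l (s l - 1); first by lia.
  exists (Ordinal i'P), t, (l, false); rewrite activeE exitsE.
  have sum_t : index_sum t = sum_max (Some (Ordinal i'P)).
    by move: sumE i_gt0; rewrite /= /block_min /block_max /=;
      case: (nat_of_ord i) => // i0; rewrite [_.-1]/=; lia.
  split.
  - by rewrite sum_t leqnn andbT; have := sum_min_max (Some (Ordinal i'P)); lia.
  - by apply/negP => /eqP /(congr1 (@nat_of_ord _)) /=; lia.
  - by rewrite sum_t eqxx orbT.
  - by rewrite /=; lia.
  - apply: ridge_subset_apex => r b; have [->|rl _] := eqVneq r l.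
      by rewrite xpair_eqE eqxx; case: b => // _; exists true;
        rewrite ?xpair_eqE ?eqxx //; lia.
    by exists b; rewrite ?xpair_eqE ?(negbTE rl) // toff.
have [_ _|slN /=] := eqVneq (s l : nat) N; first by left.
move=> /eqP sumE.
(* The top layer of the last block is also that of the union of blocks. *)
have [iK|iK] := eqVneq i.+1 nblocks.
  by left; rewrite sumE /= /block_max iK.
right; have i'P : i.+1 < nblocks by rewrite ltn_neqAle iK ltn_ord.
have [|t [tl toff sumt]] := @move_coord s l (s l + 1); first by lia.
exists (Ordinal i'P), t, (l, true); rewrite activeE exitsE.
have sum_t : index_sum t = sum_min (Some (Ordinal i'P)).
  by move: sumE; rewrite /= /block_min /block_max /=; lia.
split.
- by rewrite sum_t leqnn /=; have := sum_min_max (Some (Ordinal i'P));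
  rewrite /=; lia.
- by apply/negP => /eqP /(congr1 (@nat_of_ord _)) /=; lia.
- by rewrite sum_t eqxx orbT.
- by [].
- apply: ridge_subset_apex => r b; have [->|rl _] := eqVneq r l.
    by rewrite xpair_eqE eqxx; case: b => // _; exists false;
      rewrite ?xpair_eqE ?eqxx //; lia.
  by exists b; rewrite ?xpair_eqE ?(negbTE rl) // toff.
Qed.

Lemma attached_ridge p x y : active p -> attached p x y ->
  [/\ exit_label p x, ~~ exit_label p y &
    exists q x' y', [/\ active q, piece_rank q < piece_rank p,
      exit_label q x', ~~ exit_label q y' &
      (piece_label p @: (~: [set x; y])) \subset
      (piece_label q @: (~: [set x'; y']))]].
Proof.
case: p => k s act /and3P [xp yp att]; split=> //.
case: x xp att => [x|] // xp; case: y yp => [y|] yp att.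
  have [t [x' [y' [/andP [actt _] xt yt earlier sub]]]] :=
    ridge_neighbour act xp yp.
  exists (k, t), (Some x'), (Some y'); split=> //.
  by apply: rank_ltn; right; split => //; apply: earlier.
case: k act xp yp att => [i|] act xp _ att.
  have [xo|[i' [t [x' [actt ne xt lt sub]]]]] := apex_ridge_neighbour act xp.
    (* An upper exit from the union has coordinate 0, because index sums are at least d > 0; this
       contradicts [0 < s l]. *)
    move: act xo xp att; case: x => l c /=;
      rewrite activeE => act xo _ /andP [cT sl].
    move: cT xo => /= ->; rewrite exitsE => /orP [/eqP e|/eqP e];
      first by rewrite e in sl.
    by have := index_sum_bounds s; rewrite /= in e; lia.
  by exists (Some i', t), (Some x'), None; split=> //; apply: rank_ltn;
    left; apply: lt.
have [i acti] := active_block act.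
exists (Some i, s), (Some x), None; split=> //.
- by apply: rank_ltn; left => /=.
- move: acti act xp; case: x {att} => l [];
  rewrite /= !activeE !exitsE => acti act.
    have := index_sum_bounds s; rewrite /= => pos.
    by case/orP => [->//|/eqP]; lia.
  case/orP => [->//|/eqP e]; have := sum_max_block_outer i; rewrite -e => ?.
  by apply/orP; right; lia.
- by apply: ridge_subset_apex => r b h; exists b.
Qed.

(** In a middle layer each upper vertex of G is joined to all of F, and each lower one to none. In
    the end layers, apart from vertices of F treated uniformly, adjacency compares the positions of
    the two paths, so neighbourhoods are initial or final segments. *)
Lemma attached_nested p x y x' y' :
  attached p x y -> attached p x' y' -> attached p x y' || attached p x' y.
Proof.
case: p => k s; rewrite /attached.
case: x => [[l c]|]; rewrite ?andbF // => /and3P [xp yp att].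
case: x' => [[l' c']|]; rewrite ?andbF // => /and3P [xp' yp' att'].
rewrite xp xp' yp yp' /=; move: xp xp' yp yp' att att'.
case: y => [[m b]|]; case: y' => [[m' b']|]; rewrite /= ?orbb //.
- by case: b b' c c' => [] [] [] []; rewrite ?exitsE ?attachesE //; lia.
- by case: b c c' => [] [] []; case: k => [i|];
  rewrite ?exitsE ?attachesE //=; lia.
- by case: b' c c' => [] [] []; case: k => [i|];
  rewrite ?exitsE ?attachesE //=; lia.
- by move=> *; apply/orP; left.
Qed.

(** * What an earlier facet misses *)

Local Notation facet_of p x := (piece_facet piece_label p x).
Local Notation valid_facet := (piece_valid active exit_label flipped_piece).

Lemma corner_notin_facet k s l c q x :
  (forall b : bool, s l + c = q.2 l + b -> x = Some (l, b)) ->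
  piece_label (k, s) (Some (l, c)) \notin facet_of q x.
Proof.
move=> h; apply/imsetP => -[[[l' b]|]]; rewrite !inE => zx;
  last by rewrite /=; case: (q.1).
move/eqP; rewrite corner_eq /= => /andP [/eqP e /eqP e']; rewrite -e in zx e'.
by rewrite (h b e') eqxx in zx.
Qed.

Lemma apex_notin_facet k q x : k != q.1 -> apex k \notin facet_of q x.
Proof.
case: q => k' t /= ne; apply/imsetP => -[[z|]]; first by case: k {ne}.
move=> _; case: k k' ne => [i|] [i'|] //= ne e.
by move: ne; case: e => ->; rewrite eqxx.
Qed.

Lemma flipped_extremal k s : flipped_piece (k, s) ->
  index_sum s = sum_min k \/ index_sum s = sum_max k.
Proof.
case: k => // i /andP [_]; rewrite !inE => /orP [] /eqP; by [left|right].
Qed.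

Definition covers p q x' :=
  (exists x y, [/\ attached p x y, piece_label p x \notin facet_of q x' &
                   piece_label p y \notin facet_of q x']) \/
  ~~ flipped_piece p /\
  (exists2 y, forall x, exit_label p x -> attached p x y &
              piece_label p y \notin facet_of q x').

(** In a middle layer all exits are at ends of paths, and [attaches] joins each of them to the upper
    vertex on path [m], which lies beyond the cell of [q]. *)
Lemma covers_middle k s q x' m :
  sum_min k < index_sum s < sum_max k -> q.2 m < s m -> covers (k, s) q x'.
Proof.
move=> sums ltm; right; split.
  by apply/negP => /flipped_extremal; lia.
exists (Some (m, true)); last by apply: corner_notin_facet => -[]; lia.
have ym : ~~ exits (k, s) (m, true) by rewrite exitsE; lia.
move=> [[l c]|//] xl; rewrite /attached xl /= ym attachesE.
have {}xl : exits (k, s) (l, c) := xl.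
by case: c xl => // xl; rewrite exitsE in xl; lia.
Qed.

Lemma covers_top k s q x' :
  index_sum s = sum_max k -> index_sum q.2 < index_sum s ->
  q.1 = k \/ index_sum q.2 < sum_min k ->
  valid_facet (q, x') -> covers (k, s) q x'.
Proof.
(* A cell [t] that is nowhere two steps below [s] is too close to [s] to lie  *)
(* in the lower layer, so [q] is not flipped and [x'] is on a side of B.      *)
move: q => [k' t] /= sumE lts near /andP [/= actq modeq]; left.
have lh := sum_min_max k.
have cover l c m c' : exits (k, s) (l, c) -> ~~ exits (k, s) (m, c') ->
    attaches (k, s) (l, c) (m, c') ->
    (forall b : bool, s l + c = t l + b -> x' = Some (l, b)) ->
    (forall b : bool, s m + c' = t m + b -> x' = Some (m, b)) ->
  exists x y, [/\ attached (k, s) x y,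
    piece_label (k, s) x \notin facet_of (k', t) x' &
    piece_label (k, s) y \notin facet_of (k', t) x'].
  move=> h1 h2 h3 h4 h5; exists (Some (l, c)), (Some (m, c')).
  by split; [rewrite /attached /= h1 h2|apply: corner_notin_facet..].
have [/existsP [m hm]|/existsPn close] := boolP [exists m, (t m).+1 < s m].
  (* Both vertices of [s] on path [m] lie beyond those of [t]. *)
  by apply: (cover m false m true); rewrite ?exitsE ?attachesE //; lia.
have {}close m : s m <= (t m).+1 by rewrite leqNgt close.
have sum_le := index_sum_leqD close.
have ek : k' = k by case: near => //; lia.
rewrite ek in actq modeq cover *.
have /negbTE nflip : ~~ flipped_piece (k, t).
  by apply/negP => /flipped_extremal; lia.
rewrite nflip in modeq; case: x' modeq cover => [[r b]|//] modeq cover.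
have [m ltm] := index_sum_ltP lts; have closem := close m;
  have closer := close r.
have sN := coord_le s r; have tN := coord_le t r.
have ym : ~~ exits (k, s) (m, true) by rewrite exitsE; lia.
have ym_notin (x' : label) (b' : bool) : s m + true = t m + b' ->
  x' = Some (m, b').
  by case: b'; lia.
have {}modeq : exits (k, t) (r, b) by move: modeq; rewrite eqbF_neg negbK.
case: b modeq cover => modeq cover; rewrite exitsE in modeq.
  have tr0 : t r = 0 :> nat by lia.
  have [sr0|sr0] := posnP (s r).
    apply: (cover r true m true); rewrite ?exitsE ?attachesE ?sr0 //.
      by case=> //; lia.
    exact: ym_notin.
  apply: (cover r false r true); rewrite ?exitsE ?attachesE //; try lia.
  by case=> //; lia.
(* The facet keeps only the last vertex of path [r]. *)
have trN : t r = N :> nat by lia.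
have [srN|srN] := eqVneq (s r : nat) N.
  apply: (cover r false m true);
    rewrite ?exitsE ?attachesE ?srN ?eqxx ?orbT //; first by case=> //; lia.
  exact: ym_notin.
have [sr0|sr0] := posnP (s r).
  apply: (cover r true m true); rewrite ?exitsE ?attachesE ?sr0 //.
    by case=> //; lia.
  exact: ym_notin.
apply: (cover r false r true); rewrite ?exitsE ?attachesE //; try lia.
by case=> //; lia.
Qed.

(** In the outer cone the apex is joined to all of F and missed by every facet of a block. If the
    index sum of [q] is smaller, some coordinate is too, and its upper vertex in [p] is missed; in
    the bottom layer [q] is in an earlier block and also misses the apex. At equal sums in the same
    block, [coord_weight_exchange] gives one missed vertex on each of two paths. *)
Lemma attached_covers p q x' : active p -> valid_facet (q, x') -> q != p ->
  piece_rank q <= piece_rank p -> covers p q x'.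
Proof.
case: p => k s act vq ne /rank_leq /= le; have actq : active q by case/andP: vq.
have lh := sum_min_max k.
have [[-> knone]|[near|[qk [eqsum leq_weight]]]] : k = None /\ q.1 != None \/
    index_sum q.2 < index_sum s /\ (q.1 = k \/ index_sum q.2 < sum_min k) \/
    q.1 = k /\ index_sum q.2 = index_sum s /\
      coord_weight q.2 <= coord_weight s.
- case: q k vq actq act lh ne le => [[i'|] t] [i|] /= vq actq act lh ne le.
  + rewrite !activeE in act actq; case: le => [/sum_max_lt_min|[/ord_inj ei]] h.
      by right; left; move: act actq h => /=; lia.
    subst i'; case: h => [h|[h h']]; right; first by left; split; [|left].
    by right.
  + by left.
  + by case: le => [|[e _]]; have := ltn_ord i; lia.
  + case: le => [|[_ []]] h; [by rewrite ltnn in h|right..].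
      by left; split; [|left].
    by right; case: h.
- right; split=> //; exists None; last by apply: apex_notin_facet;
  rewrite eq_sym.
  by case=> [x|//] xp; rewrite /attached xp.
- case: near => lts near; have [m ltm] := index_sum_ltP lts.
  rewrite activeE in act;
    have [summax|summax] := eqVneq (index_sum s) (sum_max k).
    exact: covers_top.
  have [summin|summin] := eqVneq (index_sum s) (sum_min k).
    case: near => [qk|ltm']; last first.
      left; exists (Some (m, true)), None; split.
      - rewrite /attached /= exitsE summin eqxx orbT /=.
        by rewrite (leq_ltn_trans _ ltm) ?orbT.
      - by apply: corner_notin_facet => -[]; lia.
      - apply: apex_notin_facet => /=; apply: contraTneq ltm' => ->.
        by case: (q) actq => k' t; rewrite activeE -leqNgt => /andP [].
    by case: q actq qk lts {le vq ne ltm} => k' t;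
      rewrite activeE /= => h e; rewrite e in h; lia.
  by apply: covers_middle ltm; lia.
have neqt : q.2 != s.
  by apply: contra ne => /eqP <-;
    case: q qk {vq actq eqsum leq_weight le} => k' t /= ->.
have [l [m [lm ltl ltm]]] := coord_weight_exchange neqt eqsum leq_weight.
have tm := coord_le q.2 m.
rewrite activeE in act;
  have [summax|summax] := eqVneq (index_sum s) (sum_max k).
  left; exists (Some (m, false)), (Some (l, true)).
  have xm : exits (k, s) (m, false) by rewrite exitsE; lia.
  have yl : ~~ exits (k, s) (l, true) by rewrite exitsE; lia.
  split; [|by apply: corner_notin_facet => -[]; lia..].
  by rewrite /attached /= xm yl attachesE (ltnW lm) ?orbT.
have [summin|summin] := eqVneq (index_sum s) (sum_min k).
  left; exists (Some (l, true)), (Some (m, false)).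
  have xl : exits (k, s) (l, true) by rewrite exitsE; lia.
  have ym : ~~ exits (k, s) (m, false) by rewrite exitsE; lia.
  split; [|by apply: corner_notin_facet => -[]; lia..].
  by rewrite /attached /= xl ym attachesE lm (leq_ltn_trans _ ltl).
by apply: covers_middle ltl; lia.
Qed.

(** * Block boundaries and missing faces *)

Lemma index_sum_off s t l : (forall m, m != l -> t m = s m :> nat) ->
  index_sum t + s l = index_sum s + t l.
Proof.
move=> off; rewrite -(index_sum_set_coord s l (coord_le t l)).
congr (index_sum _ + _); apply: cell_index_eq => m;
  rewrite set_coordE ?coord_le //.
by case: eqVneq => [->|/off].
Qed.

(** The only other candidate left by [ridge_cells] is off the path or outside the block. *)
Lemma exit_ridge_cell k s x t : active (k, s) -> exits (k, s) x ->
  active (k, t) ->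
  cell s :\ corner s x \subset cell t -> t = s.
Proof.
rewrite !activeE; case: x => l c acts xl actt /ridge_cells [//|[off on]].
have := index_sum_off off.
by case: c xl on => xl; rewrite exitsE in xl => on; have := coord_le t l; lia.
Qed.

Lemma interior_ridge_cell k s x : active (k, s) -> ~~ exits (k, s) x ->
  exists t, [/\ active (k, t), t != s & cell s :\ corner s x \subset cell t].
Proof.
case: x => l c; rewrite activeE => acts xl.
have [t [actt off tl]] : exists t, [/\ active (k, t),
    forall m, m != l -> t m = s m :> nat &
    if c then (t l).+1 = s l :> nat else t l = (s l).+1 :> nat].
  have sl := coord_le s l; case: c xl => xl; rewrite exitsE in xl.
    have [|t [tl off sumt]] := @move_coord s l (s l - 1); first by lia.
    by exists t; rewrite activeE; split=> //; lia.
  have [|t [tl off sumt]] := @move_coord s l (s l + 1); first by lia.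
  by exists t; rewrite activeE; split=> //; lia.
exists t; split=> //.
  by apply: contraTneq isT => e; move: tl; rewrite e; case: (c); lia.
apply/subsetP => v; rewrite !inE cellE => /andP [vx /imsetP [[m b] _ vE]].
move: vx; rewrite vE (inj_eq (@corner_inj _ _ s)) corner_cell.
have [->|/off ->] := eqVneq m l; last by case: b {vE} => _; lia.
by rewrite xpair_eqE eqxx /=; move: tl; case: b c {vE xl} => [] [] //= tl _;
  rewrite ?tl; lia.
Qed.

Lemma card1_subset (T : finType) (A S : {set T}) :
  A \subset S -> #|S| = #|A|.+1 -> exists2 v, v \in S & A = S :\ v.
Proof.
move=> AS cS; have /cards1P [v vE] : #|S :\: A| == 1.
  by rewrite cardsD (setIidPr AS) cS subSnn.
have : v \in S :\: A by rewrite vE inE.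
rewrite inE => /andP [vA vS]; exists v => //.
apply/eqP; rewrite eqEcard subsetD1 AS vA /=.
by have := cardsD1 v S; rewrite vS cS add1n => -[->].
Qed.

Lemma cell_ridge s (A : {set vertex}) : A \subset cell s -> #|A| = (2 * d).-1 ->
  exists x, A = cell s :\ corner s x.
Proof.
move=> As cA; have [|v vs ->] := card1_subset As;
  first by rewrite card_cell cA; lia.
by move: vs; rewrite cellE => /imsetP [x _ ->]; exists x.
Qed.

Lemma card_cell_ridge s x : #|cell s :\ corner s x| = (2 * d).-1.
Proof.
have := cardsD1 (corner s x) (cell s); rewrite cellE imset_f ?inE // -cellE.
by rewrite card_cell => ->.
Qed.

Definition exit_ridges k : {set {set vertex}} :=
  [set cell px.1 :\ corner px.1 px.2 |
    px : cell_index * ('I_d * bool) & active (k, px.1) && exits (k, px.1) px.2].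

Lemma exit_ridgesP k A :
  reflect (exists s x,
             [/\ active (k, s), exits (k, s) x & A = cell s :\ corner s x])
          (A \in exit_ridges k).
Proof.
apply: (iffP imsetP) => [[[s x]]|[s [x [acts xs ->]]]].
  by rewrite inE => /andP [acts xs] ->; exists s, x.
by exists (s, x); rewrite ?inE ?acts.
Qed.

Lemma blockE (i : 'I_nblocks) :
  block i = generated [set cell s | s : cell_index & active (Some i, s)].
Proof.
apply/setP => A; rewrite !inE mem_B; apply/andP/existsP.
  case=> _ /existsP [s /andP [h As]]; exists (cell s).
  by rewrite As andbT; apply: imset_f; rewrite inE.
case=> _ /andP [/imsetP [s + ->] As]; rewrite inE => h.
by split; apply/existsP; exists s; rewrite // As andbT.
Qed.

Lemma block_boundaryE (i : 'I_nblocks) :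
  block_boundary i = generated (exit_ridges (Some i)).
Proof.
rewrite /block_boundary blockE boundary_generated; last first.
  by move=> _ /imsetP [s _ ->]; rewrite card_cell; lia.
congr generated; apply/setP => A; rewrite inE; apply/andP/exit_ridgesP.
  case=> /eqP cA /cards1P [F FE].
  have : F \in [set F] by rewrite inE.
  rewrite -FE inE => /andP [/imsetP [s]]; rewrite inE => acts sF;
    rewrite sF => As.
  have [x AE] := cell_ridge As cA; exists s, x; split=> //.
  apply/negPn/negP => /(interior_ridge_cell acts) [t [actt ts]];
    rewrite -AE => At.
  have : cell t \in [set F] by rewrite -FE inE At andbT imset_f // inE.
  by rewrite inE sF (inj_eq (@cell_inj _ _)) (negbTE ts).
case=> s [x [acts xs ->]]; rewrite card_cell_ridge; split=> //.
apply/cards1P; exists (cell s); apply/setP => F; rewrite !inE.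
apply/andP/eqP => [[/imsetP [t]]|->].
  by rewrite inE => actt -> /(exit_ridge_cell acts xs actt) ->.
by rewrite subD1set; split=> //; apply: imset_f; rewrite inE.
Qed.

Definition exit_face p : {set vertex} :=
  [set corner p.2 x | x : 'I_d * bool & exits p x].

(* [sum_min k + d < sum_max k] makes a cell of the opposite end of the block  *)
(* too far from [s] to share the exit face.                                   *)
Lemma exit_face_inner k s t x :
  index_sum s = sum_min k \/ index_sum s = sum_max k ->
  active (k, t) -> exits (k, t) x ->
    ~~ (exit_face (k, s) \subset cell t :\ corner t x).
Proof.
move=> ends; rewrite activeE; case: x => m c actt xt;
  apply/negP => /subsetP sub.
have lh := sum_min_max k.
have inF l b : exits (k, s) (l, b) ->
    (s l + b = t l \/ s l + b = (t l).+1) /\ (l = m -> s m + b <> t m + c).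
  move=> xl; have : corner s (l, b) \in exit_face (k, s).
    by rewrite imset_f ?inE.
  move/sub; rewrite !inE corner_cell corner_eq /= => /andP [h1 h2].
  by split=> [|e]; [lia|rewrite e eqxx /= in h1; lia].
have sm := coord_le s m; have tm := coord_le t m.
case: ends => sumE.
  have up l : s l <= t l <= (s l).+1.
    by have [] := inF l true _; rewrite ?exitsE ?sumE ?eqxx ?orbT //; lia.
  have [|_ /(_ erefl) ne] := inF m true; first by rewrite exitsE sumE eqxx orbT.
  have upm := up m; case: c inF ne xt {sub} => inF ne xt; rewrite exitsE in xt.
    have lt : s m < t m by lia.
    by have := index_sum_ltn (fun l => proj1 (andP (up l))) lt; lia.
  have e : t m = s m :> nat by lia.
  have [smN|smN] := eqVneq (s m : nat) N.
    by have [|_ /(_ erefl)] := inF m false; rewrite ?exitsE ?smN ?eqxx //; lia.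
  by have := index_sum_leqD (fun l => proj2 (andP (up l))); lia.
have down l : t l <= s l <= (t l).+1.
  by have [] := inF l false _; rewrite ?exitsE ?sumE ?eqxx ?orbT //; lia.
have [|_ /(_ erefl) ne] := inF m false; first by rewrite exitsE sumE eqxx orbT.
have downm := down m; case: c inF ne xt {sub} => inF ne xt;
  rewrite exitsE in xt.
  have e : t m = s m :> nat by lia.
  have [sm0|sm0] := posnP (s m).
    by have [|_ /(_ erefl)] := inF m true; rewrite ?exitsE ?sm0 //; lia.
  by have := index_sum_leqD (fun l => proj2 (andP (down l))); lia.
have lt : t m < s m by lia.
by have := index_sum_ltn (fun l => proj1 (andP (down l))) lt; lia.
Qed.

Lemma in_ends (i : 'I_nblocks) s : (s \in lower i :|: upper i) =
  (index_sum s == sum_min (Some i)) || (index_sum s == sum_max (Some i)).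
Proof. by rewrite !inE. Qed.

Lemma ends_active (i : 'I_nblocks) s : s \in lower i :|: upper i ->
  active (Some i, s).
Proof.
by rewrite in_ends activeE => /orP [] /eqP ->; have := sum_min_max (Some i);
  lia.
Qed.

Lemma exit_face_subset p : exit_face p \subset cell p.2.
Proof. by apply/subsetP => _ /imsetP [x _ ->]; rewrite cellE imset_f. Qed.

(** A boundary face lies in an exit ridge of some cell, and by [exit_face_inner] none of these
    contains the exit face. A face that misses an exit vertex lies in the opposite ridge. *)
Lemma cell_boundaryE (i : 'I_nblocks) s A : s \in lower i :|: upper i ->
  (A \in cell_boundary i s) =
  (A \subset cell s) && ~~ (exit_face (Some i, s) \subset A).
Proof.
move=> ends; have acts := ends_active ends.
rewrite in_setI powersetE block_boundaryE; apply: andb_id2l => As;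
  apply/generatedP/idP.
  case=> _ /exit_ridgesP [t [x [actt xt ->]]] At; apply/negP => FA.
  suff /negP[] : ~~ (exit_face (Some i, s) \subset cell t :\ corner t x).
    exact: subset_trans FA At.
  apply: exit_face_inner => //.
  by move: ends; rewrite in_ends => /orP [] /eqP; [left|right].
case/subsetPn => _ /imsetP [x xs ->] xA; exists (cell s :\ corner s x).
  by apply/exit_ridgesP; exists s, x; rewrite inE in xs.
by rewrite subsetD1 As.
Qed.

Lemma FfaceE (i : 'I_nblocks) s : s \in lower i :|: upper i ->
  Fface i s = exit_face (Some i, s).
Proof.
move=> ends; have missing F : missing_face (cell_boundary i s) (cell s) F =
    (F == exit_face (Some i, s)).
  rewrite /missing_face cell_boundaryE //; apply/and3P/eqP => [[Fs]|->].
    rewrite Fs /= negbK => sub /forallP /(_ (exit_face (Some i, s))).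
    rewrite cell_boundaryE // subxx andbF implybF properE sub negbK => sub'.
    by apply/eqP; rewrite eqEsubset sub sub'.
  rewrite exit_face_subset subxx; split=> //; apply/forallP => G; apply/implyP.
  rewrite properE cell_boundaryE // => /andP [GF ->]; rewrite andbT.
  exact: subset_trans GF (exit_face_subset _).
rewrite /Fface; case: pickP => [F|/(_ (exit_face (Some i, s)))];
  rewrite missing.
  by move/eqP.
by rewrite eqxx.
Qed.

(** * Facets and boundary of the new ball, and the sphere *)

Lemma piece_labelT k s : piece_label (k, s) @: setT = apex k |: cell s.
Proof.
apply/setP => v; rewrite in_setU1 cellE; apply/imsetP/orP.
  by case=> [[x|]] _ ->; [right; apply: imset_f|left].
case=> [/eqP ->|/imsetP [x _ ->]]; first by exists None.
by exists (Some x).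
Qed.

Lemma apex_notin_cell k s : apex k \notin cell s.
Proof. by rewrite cellE; apply/imsetP => -[x _]; case: k. Qed.

Lemma facet_apex k s : facet_of (k, s) None = cell s.
Proof.
apply/setP => v; rewrite cellE; apply/imsetP/imsetP => [[[x|]]|[x _ ->]].
- by move=> _ ->; exists x.
- by rewrite !inE eqxx.
- by exists (Some x); rewrite ?inE.
Qed.

Lemma facetE k s x :
  facet_of (k, s) x = (apex k |: cell s) :\ piece_label (k, s) x.
Proof.
rewrite -piece_labelT; apply/setP => v; rewrite in_setD1.
apply/imsetP/andP => [[y yx ->]|[vx /imsetP [y _ vE]]].
  by rewrite (inj_eq (@piece_label_inj _)) imset_f // -in_setC1.
by exists y => //; rewrite in_setC1; apply: contraNneq vx => <-; rewrite vE.
Qed.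

Lemma facet_corner k s x :
  facet_of (k, s) (Some x) = apex k |: (cell s :\ corner s x).
Proof.
rewrite facetE /= setDUl; congr (_ :|: _); apply/setDidPl.
rewrite disjoints1; apply: contra (apex_notin_cell k s).
by rewrite inE => /eqP ->; rewrite cellE imset_f.
Qed.

Definition facets_at p : {set {set vertex}} :=
  [set facet_of p x | x in [pred x | exit_label p x != flipped_piece p]].

(** Faces of [T1] are the subsets of cell and apex that do not contain G, so its facets omit one
    vertex of G; for [T2], replace G by F. *)
Lemma flipped_cellE (i : 'I_nblocks) s : s \in lower i :|: upper i ->
  (if j s then T1 i s else T2 i s) = generated (facets_at (Some i, s)).
Proof.
move=> ends; pose p : piece := (Some i, s); pose F := Fface i s.
pose G := block_apex i |: Gface i s.
have FE : F = exit_face p by apply: FfaceE.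
have sub_FG (H : {set vertex}) : H \subset cell s ->
  H :|: (block_apex i |: (cell s :\: H)) = apex p.1 |: cell s.
  by move=> Hs; rewrite setUCA setDE setUIr setUCr setIT (setUidPr Hs).
have FG : F :|: G = apex p.1 |: cell s.
  by rewrite sub_FG // FE exit_face_subset.
have inF y : (piece_label p y \in F) = exit_label p y.
  rewrite FE; case: y => [x|] /=; last first.
    by apply/negbTE; apply/imsetP => -[x _].
  by rewrite mem_imset ?inE //; apply: corner_inj.
have inG y : (piece_label p y \in G) = ~~ exit_label p y.
  rewrite in_setU1 /Gface in_setD -/F inF; case: y => [x|] /=.
    by rewrite cellE imset_f // andbT.
  by rewrite eqxx.
have FG0 : [disjoint F & G].
  rewrite disjoint_subset; apply/subsetP => v; rewrite FE => /imsetP [x xF ->].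
  by rewrite inE in xF; have := inG (Some x); rewrite /= xF !inE => ->.
have labP v : v \in F :|: G -> exists y, v = piece_label p y.
  by rewrite FG -(piece_labelT p.1 s) => /imsetP [y _ ->]; exists y.
have subP (H A : {set vertex}) : H \subset F :|: G ->
    reflect (exists2 y, piece_label p y \in H & A \subset facet_of p y)
            ((A \subset F :|: G) && ~~ (H \subset A)).
  move=> HFG; apply: (iffP andP) => [[AFG /subsetPn [v vH vA]]|[y yH]].
    have [y vE] := labP v (subsetP HFG v vH); exists y; rewrite -?vE //.
    by rewrite facetE -[piece_label _ _]vE subsetD1 -FG AFG.
  rewrite facetE subsetD1 -FG => /andP [AFG yA]; split=> //.
  by apply/subsetPn; exists (piece_label p y).
have flip : flipped_piece p = j s by rewrite /flipped_piece /= ends andbT.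
have facetP (A : {set vertex}) : reflect
    (exists2 y, exit_label p y != j s & A \subset facet_of p y)
    (A \in generated (facets_at p)).
  apply: (iffP (generatedP _ _)) => [[_ /imsetP [y + ->] Ay]|[y yj Ay]].
    by rewrite inE flip; exists y.
  by exists (facet_of p y); rewrite // imset_f // inE flip.
apply/setP => A; case js: (j s) facetP => facetP.
  rewrite join_simplex_boundary //.
  apply/(subP _ _ (subsetUr F G))/facetP => -[y yG Ay]; exists y => //;
    by rewrite inG eqb_id in yG *.
rewrite join_boundary_simplex //.
apply/(subP _ _ (subsetUl F G))/facetP => -[y yF Ay]; exists y => //;
  by rewrite inF eqbF_neg negbK in yF *.
Qed.

Lemma side_ridgesP (i : 'I_nblocks) (A : {set vertex}) :
  reflect (exists s x, [/\ active (Some i, s), s \notin lower i :|: upper i,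
             exits (Some i, s) x & A = cell s :\ corner s x])
          (A \in side_ridges i).
Proof.
rewrite inE block_boundaryE; apply: (iffP and3P).
  case=> /generatedP [_ /exit_ridgesP [s [x [acts xs ->]]] As] /eqP cA
    /forall_inP side.
  have AE : A = cell s :\ corner s x.
    by apply/eqP; rewrite eqEcard As cA card_cell_ridge leqnn.
  exists s, x; split=> //;
    apply: contraL (subD1set (cell s) (corner s x)) => /side.
  by rewrite AE.
case=> s [x [acts mid xs ->]]; split.
- by apply/generatedP; exists (cell s :\ corner s x) => //;
  apply/exit_ridgesP; exists s, x.
- by rewrite card_cell_ridge.
- apply/forall_inP => t ends; apply: contra mid.
  by move/(exit_ridge_cell acts xs (ends_active ends)) => <-.
Qed.

Lemma flipped_middle (i : 'I_nblocks) s :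
  s \notin lower i :|: upper i -> flipped_piece (Some i, s) = false.
Proof. by move=> /negbTE mid; rewrite /flipped_piece /= mid andbF. Qed.

Definition piece_facets (inner : bool) : {set {set vertex}} :=
  [set facet_of px.1 px.2 |
    px in [pred px | valid_facet px && (inner ==> (px.1.1 != None))]].

Lemma new_ballE : new_ball j = generated (piece_facets true).
Proof.
apply/setP => A; apply/bigcupP/generatedP.
  case=> i _; rewrite in_setU.
  case/orP=> [/bigcupP [s ends]|/bigcupP [R /side_ridgesP]].
    rewrite flipped_cellE // => /generatedP [_ /imsetP [x + ->] Ax];
      rewrite inE => mx.
    exists (facet_of (Some i, s) x) => //.
    by apply/imsetP; exists ((Some i, s), x);
      rewrite // inE /= andbT /piece_valid /= ends_active.
  case=> s [x [acts mid xs ->]];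
    rewrite powersetE -[block_apex i]/(apex (Some i)) -facet_corner => Ax.
  exists (facet_of (Some i, s) (Some x)) => //.
  apply/imsetP; exists ((Some i, s), Some x);
    rewrite // inE /= andbT /piece_valid /= acts xs.
  by rewrite flipped_middle.
case=> _ /imsetP [[[k s] x] + ->] /= Ax;
  rewrite inE /= => /andP [/andP [/= acts mx]].
case: k acts mx Ax => [i|//] acts mx Ax _; exists i => //; rewrite in_setU;
  apply/orP.
have [ends|mid] := boolP (s \in lower i :|: upper i); [left|right].
  apply/bigcupP; exists s => //; rewrite flipped_cellE //; apply/generatedP.
  by exists (facet_of (Some i, s) x) => //; apply: imset_f; rewrite inE.
move: mx; rewrite flipped_middle // eqbF_neg negbK; case: x Ax => [x|//] Ax xs.
apply/bigcupP; exists (cell s :\ corner s x).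
  by apply/side_ridgesP; exists s, x.
by rewrite powersetE -[block_apex i]/(apex (Some i)) -facet_corner.
Qed.

Lemma card_labels : #|{: label}| = (2 * d).-1.+2.
Proof. by rewrite card_label; lia. Qed.

Lemma card_facet p x : #|facet_of p x| = (2 * d).-1.+1.
Proof. exact: card_piece_facet piece_label_inj card_labels p x. Qed.

Lemma facet_inj p x q y : valid_facet (p, x) -> valid_facet (q, y) ->
  facet_of p x = facet_of q y -> p = q /\ x = y.
Proof.
move=> vx vy e.
have := (piece_facet_inj piece_label_inj attached_ridge
  (fun p x y x' y' _ => @attached_nested p x y x' y') attached_covers
  vx vy e).
by case=> -> ->.
Qed.

Lemma facet_ridge p x y :
  facet_of p x :\ piece_label p y = piece_label p @: (~: [set x; y]).
Proof.
apply/setP => v; apply/setD1P/imsetP => [[vy /imsetP [z zx vE]]|[z zxy ->]].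
  exists z => //; move: zx vy; rewrite vE !inE negb_or => -> /=.
  by apply: contraNneq => ->.
move: zxy; rewrite !inE negb_or => /andP [zx zy].
by rewrite (inj_eq (@piece_label_inj _)) zy imset_f // !inE.
Qed.

Lemma exits_outer (i : 'I_nblocks) s x :
  active (Some i, s) -> exits (None, s) x -> exits (Some i, s) x.
Proof.
move=> acti; have pos := index_sum_bounds s; have := sum_max_block_outer i.
move: acti; case: x => l []; rewrite activeE !exitsE => acti le.
  by case/orP => [->//|/eqP] /= e; move: pos; rewrite e; lia.
by case/orP => [->//|/eqP e]; apply/orP; right; move: le acti; rewrite -e; lia.
Qed.

(** A ridge opposite to two vertices on the same side of a piece lies in two facets of that piece.
    If the vertices are on different sides, a neighbouring piece supplies the second facet, unless
    one of them is the apex and the other exits from the union of blocks. *)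
Lemma new_ball_boundaryE :
  boundary (2 * d).-1 (new_ball j) = generated (exit_ridges None).
Proof.
rewrite new_ballE boundary_generated; last by move=> _ /imsetP [px _ ->];
  apply: card_facet.
congr generated; apply/setP => A; rewrite inE; apply/andP/exit_ridgesP.
  case=> /eqP cA /cards1P [F FE].
  have inF : F \in [set F] by rewrite inE.
  have uniqF p x : valid_facet (p, x) -> p.1 != None ->
      A \subset facet_of p x -> facet_of p x = F.
    move=> vx px Ax; apply/eqP; rewrite -in_set1 -FE inE Ax andbT.
    by apply/imsetP; exists (p, x); rewrite // inE vx.
  move: inF; rewrite -FE inE => /andP [/imsetP [[[k s] x]]].
  rewrite inE /= => /andP [vx kP] FEx; case: k kP vx FEx => // i _ vx FEx AF.
  set p : piece := (Some i, s) in vx FEx.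
  have [|v vF AE] := card1_subset AF; first by rewrite FEx card_facet cA.
  have [y yx vE] : exists2 y, y != x & v = piece_label p y.
    by move: vF; rewrite FEx => /imsetP [y + ->]; rewrite in_setC1; exists y.
  have {}AE : A = piece_label p @: (~: [set x; y]).
    by rewrite AE vE FEx facet_ridge.
  have [actp modex] := andP vx; rewrite /= in actp modex.
  have [exy|nexy] := eqVneq (exit_label p y) (exit_label p x).
    have vy : valid_facet (p, y) by rewrite /piece_valid /= actp exy.
    have Ay : A \subset facet_of p y.
      by rewrite AE; apply: imsetS; apply/subsetP => z;
        rewrite !inE negb_or => /andP [].
    have [_ xy] :=
      facet_inj vx vy (etrans (esym FEx) (esym (uniqF _ _ vy isT Ay))).
    by rewrite xy eqxx in yx.
  (* Flipped or not, [q] would contribute a second facet containing the ridge. *)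
  have no_other q a b : active q -> q.1 != None -> q != p ->
      exit_label q a -> ~~ exit_label q b ->
      A \subset piece_label q @: (~: [set a; b]) -> False.
    move=> actq q1 qp qa qb Aq.
    pose z := if flipped_piece q then b else a.
    have vz : valid_facet (q, z).
      by rewrite /piece_valid /= actq /z; case: ifP => _;
        rewrite ?qa ?(negbTE qb).
    have Az : A \subset facet_of q z.
      apply: (subset_trans Aq); apply: imsetS; apply/subsetP => w.
      by rewrite !inE negb_or /z => /andP [? ?]; case: ifP.
    have [pq _] := facet_inj vx vz (etrans (esym FEx) (esym (uniqF _ _ vz q1
      Az))).
    by rewrite pq eqxx in qp.
  have [a [b [ea eb ab]]] : exists a b, [/\ exit_label p a, ~~ exit_label p b &
      [set x; y] = [set a; b]].
    case ex: (exit_label p x) nexy => ney.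
      by exists x, y; split=> //; move: ney; case: exit_label.
    by exists y, x; split; rewrite ?ex 1?setUC //; move: ney; case: exit_label.
  rewrite ab in AE; case: a ea AE {ab} => [a|//] ea; case: b eb => [b|] eb AE.
    have [t [x' [y' [/andP [actt ts] xt yt _ sub]]]] :=
      ridge_neighbour actp ea eb.
    case: (@no_other (Some i, t) (Some x') (Some y')) => //; last by rewrite AE.
    by rewrite xpair_eqE eqxx.
  case: (apex_ridge_neighbour actp ea) => [xo|[i' [t [x' [actt ne xt _ sub]]]]].
    exists s, a; split=> //;
      first exact: (active_outer (actp : active (Some i, s))).
    by rewrite AE setUC -facet_ridge facet_apex.
  case: (@no_other (Some i', t) (Some x') None) => //; last by rewrite AE.
  by rewrite xpair_eqE; apply: contra ne => /andP [/eqP [->]].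
case=> s [x [acts xs ->]]; rewrite card_cell_ridge; split=> //.
have [i acti] := active_block acts; have xi := exits_outer acti xs.
(* The facets of the piece that contain this ridge omit the apex or [x]; these are on different
   sides, so exactly one is valid. *)
pose y := if flipped_piece (Some i, s) then None else Some x.
have sub y' : y' = None \/ y' = Some x ->
  cell s :\ corner s x \subset facet_of (Some i, s) y'.
  by case=> ->; rewrite ?facet_apex ?subD1set // facet_corner subsetUr.
apply/cards1P; exists (facet_of (Some i, s) y); apply/setP => F; rewrite !inE.
apply/andP/eqP => [[/imsetP [[[k t] z] + ->]]|->]; last first.
  split; last by apply: sub; rewrite /y; case: ifP; [left|right].
  apply/imsetP; exists ((Some i, s), y);
    rewrite // inE /= andbT /piece_valid /= acti /y.
  by case: ifP => _ //=; rewrite xi.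
rewrite inE /= => /andP [/andP [/= actt mz]];
  case: k actt mz => // i' actt mz _ subz.
have in_z v : v != x -> corner s v \in facet_of (Some i', t) z.
  move=> vx; apply: (subsetP subz);
    rewrite !inE (inj_eq (@corner_inj _ _ s)) vx.
  by rewrite cellE imset_f.
have ts : t = s.
  apply: (exit_ridge_cell acts xs (active_outer actt)).
  apply/subsetP => v; rewrite !inE cellE => /andP [vx /imsetP [w _ vE]].
  move: vx; rewrite vE (inj_eq (@corner_inj _ _ s)) => /in_z.
  by rewrite facetE inE => /andP [_]; rewrite in_setU1 => /orP [/eqP|//];
    case: (i').
rewrite ts in actt mz in_z *; rewrite (active_block_inj actt acti) in mz in_z *.
have zx : z = None \/ z = Some x.
  case: z in_z {mz subz} => [w|] in_z; [right|by left].
  have [->//|wx] := eqVneq w x.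
  by have := in_z w wx; rewrite facetE /= !inE eqxx.
congr (piece_facet _ _ _); move: mz; rewrite /y.
by case: zx => ->; case: flipped_piece; rewrite /= ?xi.
Qed.

(** The cone over an exit ridge of the union is the facet of the unflipped outer piece of that cell
    with the exit vertex deleted. *)
Lemma NSW_sphereE : NSW_sphere j = generated (piece_facets false).
Proof.
rewrite /NSW_sphere new_ball_boundaryE cone_generated new_ballE.
apply/setP => A; rewrite in_setU; apply/orP/generatedP.
  case=> /generatedP [_ /imsetP [px + ->] AF].
    rewrite inE => /andP [vx _]; exists (facet_of px.1 px.2) => //.
    by apply: imset_f; rewrite inE vx.
  case/exit_ridgesP=> s [x [acts xs RE]].
  exists (facet_of (None, s) (Some x)); last by rewrite facet_corner -RE.
  by apply/imsetP; exists ((None, s), Some x);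
    rewrite // inE /piece_valid /= acts xs.
case=> _ /imsetP [[[k s] x] + ->] /= Ax; rewrite inE /= andbT => vx.
case: k vx Ax => [i|] vx Ax; [left|right]; apply/generatedP.
  by exists (facet_of (Some i, s) x) => //; apply/imsetP;
    exists ((Some i, s), x); rewrite // inE vx.
case/andP: vx => /= acts; case: x Ax => [x|//] Ax; rewrite eqbF_neg negbK => xs.
exists (outer_apex d N.+2 |: (cell s :\ corner s x));
  last by rewrite -[outer_apex _ _]/(apex None) -facet_corner.
by apply: imset_f; apply/exit_ridgesP; exists s, x.
Qed.

Lemma NSW_sphere_shellable : shellable (2 * d).-1 (NSW_sphere j).
Proof.
rewrite NSW_sphereE.
have card_facets F : F \in piece_facets false -> #|F| = (2 * d).-1.+1.
  by case/imsetP => px _ ->; apply: card_facet.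
split.
  apply/andP; split.
    apply: simplicial_complex_generated; apply/set0Pn.
    pose s : cell_index := [ffun=> ord0].
    exists (facet_of (None, s) (Some (Ordinal d_gt0, true))).
    apply/imsetP; exists ((None, s), Some (Ordinal d_gt0, true));
      rewrite // inE /piece_valid /=.
    have -> : active (None, s).
      rewrite activeE; have := sum_min_max None.
      have -> : index_sum s = d; last by rewrite /=; lia.
      rewrite /index_sum; under eq_bigr do rewrite ffunE.
      by rewrite sum1_card card_ord.
    by rewrite exitsE ffunE.
  by apply/forall_inP => F;
    rewrite (facets_generated card_facets) => /card_facets ->.
apply: (flip_shelling piece_label_inj card_labels attached_ridge
  (fun p x y x' y' _ => @attached_nested p x y x' y') attached_covers).
rewrite (facets_generated card_facets) /piece_facets.
apply/setP => F; apply/imsetP/imsetP => -[px vx ->]; exists px => //.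
  by rewrite inE andbT in vx.
by rewrite inE andbT.
Qed.

End Pieces.

Theorem theorem1p1 (d n : nat) (hd : 2 <= d) (hn : 3 <= n)
  (j : cell_index d n -> bool) : shellable (2 * d).-1 (NSW_sphere j).
Proof.
by case: n hn j => [|[|N]] // _ j; apply: NSW_sphere_shellable (ltnW hd) j.
Qed.
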